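(* Let $d\ge 3$ and let $K$ be a $(d-1)$-dimensional simplicial complex which is $2$-CM (doubly Cohen-Macaulay) over some field. Then the $1$-skeleton of $K$ (the graph of vertices and edges of $K$) is generically $d$-rigid.
   Context: All simplicial complexes are finite abstract simplicial complexes. For a simplicial complex $L$ and a face $T\in L$ (including $T=\emptyset$), the link is $lk_L(T)=\{S\in L: T\cap S=\emptyset,\ T\cup S\in L\}$. $L$ is Cohen-Macaulay (CM) over a field $k$ if it is pure and for every face $T\in L$ (including the empty set) and every $i<\dim lk_L(T)$, the reduced homology $\tilde H_i(lk_L(T);k)$ vanishes. For a vertex $v$ of $K$, $K-v=\{T\in K: v\notin T\}$. $K$ is $2$-CM over $k$ if $K$ is CM over $k$ and for every vertex $v\in K$, $K-v$ is CM over $k$ of the same dimension as $K$. Let $G=(V,E)$ be a finite graph. A $d$-embedding of $G$ is any map $f:V\to\mathbb{R}^d$. It is rigid if there exists $\varepsilon>0$ such that whenever $g:V\to\mathbb{R}^d$ satisfies $\mathrm{dist}(f(v),g(v))<\varepsilon$ for every $v\in V$ and $\mathrm{dist}(g(u),g(w))=\mathrm{dist}(f(u),f(w))$ for every $\{u,w\}\in E$, then $\mathrm{dist}(g(u),g(w))=\mathrm{dist}(f(u),f(w))$ for all $u,w\in V$ (Euclidean distance). $G$ is generically $d$-rigid if the set of its rigid $d$-embeddings contains an open and dense subset of the topological vector space $(\mathbb{R}^d)^V$ of all its $d$-embeddings. Equivalently: for $V=[n]$ let $Rig(G,f)$ be the $dn\times|E|$ matrix whose column indexed by the edge $\{v<u\}$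 has the vector $f(v)-f(u)$ in the $d$ rows corresponding to $v$, the vector $f(u)-f(v)$ in the $d$ rows corresponding to $u$, and zeros elsewhere; then $G$ is generically $d$-rigid iff, for generic $f$, the column spaces of $Rig(G,f)$ and $Rig(K_V,f)$ coincide, where $K_V$ is the complete graph on $V$. *)

(* Defs.v *)
From mathcomp Require Import all_boot all_order all_algebra.
From mathcomp Require Import boolp classical_sets functions reals topology normedtype.
(* Last, so that [set x], set0, :|: etc. denote finite sets. *)
From mathcomp Require Import finset.

Set Implicit Arguments.
Unset Strict Implicit.
Unset Printing Implicit Defensive.

Import GRing.Theory Num.Theory numFieldNormedType.Exports.
Local Open Scope ring_scope.

Section Complexes.
Variable V : finType.
Implicit Types (K L : {set {set V}}) (S T : {set V}).

(* The elements of V need not all be vertices of K: links and vertex deletions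
   are again families over the same V. *)
Definition simplicial_complex K : Prop :=
  set0 \in K /\ forall S T, S \in K -> T \subset S -> T \in K.

Definition face_dim S : int := #|S|%:Z - 1.

Definition cplx_dim K : int := (\max_(S in K) #|S|)%N%:Z - 1.

Definition pure K : Prop :=
  forall S, maxset (fun T => T \in K) S -> face_dim S = cplx_dim K.

Definition link L T : {set {set V}} :=
  [set S in L | (T :&: S == set0) && (T :|: S \in L)].

Definition deletion K (v : V) : {set {set V}} := [set T in K | v \notin T].

Section ReducedHomology.
Variable k : fieldType.

(* Simplicial chains are oriented by the enumeration order of V, and the empty
   face is a generator in degree -1, so that the boundary is the augmented
   one. *)
Definition is_chain L (i : int) (c : {ffun {set V} -> k}) : Prop :=
  forall S, c S != 0 -> S \in L /\ face_dim S = i.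

(* The coefficient of S in the boundary of v |: S is (-1)^p, with p the position
   (from 0) of v in v |: S. *)
Definition boundary (c : {ffun {set V} -> k}) : {ffun {set V} -> k} :=
  [ffun S : {set V} => \sum_(v | v \notin S)
     (-1) ^+ #|[set u in S | (enum_rank u < enum_rank v)%N]| * c (v |: S)].

Definition is_cycle L i c : Prop := is_chain L i c /\ boundary c = 0.

Definition is_boundary L i c : Prop :=
  exists2 b, is_chain L (i + 1) b & boundary b = c.

Definition reduced_homology_vanishes L (i : int) : Prop :=
  forall c, is_cycle L i c -> is_boundary L i c.

Definition CM L : Prop :=
  pure L /\
  forall T, T \in L -> forall i : int, i < cplx_dim (link L T) ->
    reduced_homology_vanishes (link L T) i.

Definition two_CM K : Prop :=
  CM K /\
  forall v, [set v] \in K ->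
    CM (deletion K v) /\ cplx_dim (deletion K v) = cplx_dim K.

End ReducedHomology.

Definition vertex K : finType := {v : V | [set v] \in K}.

Definition skeleton1 K : rel (vertex K) :=
  fun u w => (u != w) && ([set val u; val w] \in K).

End Complexes.

Arguments skeleton1 {V} K _ _.

Section Rigidity.
Variables (R : realType) (d : nat).

(* The library norm on 'rV[R]_d is the max norm, hence this definition. *)
Definition euclid_dist (x y : 'rV[R]_d) : R :=
  Num.sqrt (\sum_(i < d) (x 0 i - y 0 i) ^+ 2).

Variables (V : finType) (e : rel V).

Definition rigid (f : V -> 'rV[R]_d) : Prop :=
  exists2 eps : R, 0 < eps &
    forall g : V -> 'rV[R]_d,
      (forall v, euclid_dist (f v) (g v) < eps) ->
      (forall u w, e u w -> euclid_dist (g u) (g w) = euclid_dist (f u) (f w)) ->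
      forall u w, euclid_dist (g u) (g w) = euclid_dist (f u) (f w).

(* {ptws _ -> _} carries the product topology. *)
Definition generically_rigid : Prop :=
  exists U : set {ptws V -> 'rV[R]_d},
    [/\ open U, dense U & forall f, U f -> rigid f].

End Rigidity.

(* Main.v *)
Require Import Defs.
From HB Require Import structures.
From mathcomp Require Import all_boot all_order all_algebra.
From mathcomp Require Import all_reals.
From mathcomp Require Import boolp classical_sets functions topology normedtype.
(* Last, so that [set x], set0, :|: etc. denote finite sets. *)
From mathcomp Require Import fintype finset.
From mathcomp Require Import ring lra.

(* Equal edge lengths at f and g make f - g an infinitesimal motion at the
   midpoint of f and g, so it suffices that for generic h every infinitesimal
   motion of the 1-skeleton of K is trivial.

   For the support of a minimal (d-1)-cycle c this is Fogelsanger's theorem,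
   proved by induction on the number of vertices. Contract an edge uv: the part of
   c off uv is a sum of minimal vectors e whose contraction is a cycle. Each of
   these contracts to a smaller minimal cycle (or to a single simplex), which is
   rigid, and closes up to a cycle containing uv, in which u and v have d - 1
   common neighbours because d >= 3; so vertex splitting makes it rigid. By
   minimality of c the pieces cannot be separated without a simplex containing uv
   being shared, so they move together.

   In a 2-CM complex two facets with a common ridge lie in a common minimal cycle
   (Nevo), and all facets are connected through ridges because links are
   connected in degree 0. *)

Set Implicit Arguments.
Unset Strict Implicit.
Unset Printing Implicit Defensive.

Import Order.TTheory GRing.Theory Num.Theory numFieldNormedType.Exports.
Local Open Scope ring_scope.

(** * Simplicial chains *)

(** The contraction of a minimal cycle along an edge need not be minimal, and it may be zero, so
    induction cannot be applied to it directly. This is why [c] is cut into pieces, which are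
    minimal for another linear condition: to live on the simplices of [c] that do not contain uv,
    and to have a cycle as contraction. Equivalently, they become cycles once suitable sets
    containing uv are added. No simplex of a piece contains uv, but its closing has one that does.
    The d - 2 other vertices of that simplex, and one more obtained by exchanging one of them, are
    the d - 1 common neighbours; d >= 3 leaves a vertex to exchange.

    Genericity is kept algebraic: an open set that a line leaves only at roots of a nonzero
    polynomial. This form passes to finite intersections and yields density. There may be infinitely
    many minimal vectors, so intersections run over their supports. *)

Section Chains.
Variables (V : finType) (k : fieldType).
Notation chain := {ffun {set V} -> k}.
Implicit Types (u v w x : V) (S T : {set V}) (c : chain).

Definition before v S : {set V} := [set x in S | (enum_rank x < enum_rank v)%N].

Definition sgn v S : k := (-1) ^+ #|before v S|.

Lemma sgnU1 v w S : w \notin S ->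
  sgn v (w |: S) = (-1) ^+ (enum_rank w < enum_rank v)%N * sgn v S.
Proof.
move=> wS; rewrite /sgn -exprD; apply: (congr1 (fun n => (-1) ^+ n)).
have [lt|nlt] := boolP (enum_rank w < enum_rank v)%N.
  have -> : before v (w |: S) = w |: before v S.
    by apply/setP=> x; rewrite !inE; have [->|_] := eqVneq x w; rewrite ?lt.
  by rewrite cardsU1 inE (negPf wS).
apply: eq_card => x; rewrite !inE.
by have [->|_] := eqVneq x w; rewrite ?(negPf wS) ?(negPf nlt).
Qed.

Lemma sgnU1_id v S : sgn v (v |: S) = sgn v S.
Proof.
apply: (congr1 (fun n => (-1) ^+ n)); apply: eq_card => x; rewrite !inE.
by have [->|_] := eqVneq x v; rewrite ?ltnn ?andbF.
Qed.

Lemma sgnD1_id v S : sgn v (S :\ v) = sgn v S.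
Proof.
apply: (congr1 (fun n => (-1) ^+ n)); apply: eq_card => x; rewrite !inE.
by have [->|_] := eqVneq x v; rewrite ?ltnn ?andbF.
Qed.

Lemma sgn_neq0 v S : sgn v S != 0.
Proof. by rewrite signr_eq0. Qed.

Lemma sgnK v S : sgn v S * sgn v S = 1.
Proof. by rewrite -expr2 sqrr_sign. Qed.

Lemma sign_rank v w : v != w ->
  (-1) ^+ (enum_rank w < enum_rank v)%N
  = - ((-1) ^+ (enum_rank v < enum_rank w)%N) :> k.
Proof.
move=> vw; have : enum_rank v != enum_rank w by rewrite (inj_eq enum_rank_inj).
rewrite -(inj_eq val_inj) /=; case: ltngtP => //= _ _; by rewrite ?opprK.
Qed.

Definition scale (a : k) c : chain := [ffun S => a * c S].

(* Interior and exterior multiplication by v in the exterior algebra on V. *)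
Definition lk v c : chain := [ffun S : {set V} => if v \in S then 0 else sgn v S * c (v |: S)].
Definition jn v c : chain := [ffun S : {set V} => if v \in S then sgn v S * c (S :\ v) else 0].

Lemma lk_is_zmod v : zmod_morphism (lk v).
Proof.
move=> b c; apply/ffunP=> S; rewrite !ffunE; case: ifP => _; rewrite ?subrr //.
by rewrite mulrBr.
Qed.
HB.instance Definition _ v :=
  GRing.isZmodMorphism.Build chain chain (lk v) (lk_is_zmod v).

Lemma lk_scale v a c : lk v (scale a c) = scale a (lk v c).
Proof. by apply/ffunP=> S; rewrite !ffunE; case: ifP; rewrite ?mulr0 // mulrCA. Qed.

Lemma jn_is_zmod v : zmod_morphism (jn v).
Proof.
move=> b c; apply/ffunP=> S; rewrite !ffunE; case: ifP => _; rewrite ?subrr //.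
by rewrite mulrBr.
Qed.
HB.instance Definition _ v :=
  GRing.isZmodMorphism.Build chain chain (jn v) (jn_is_zmod v).

Lemma jn_scale v a c : jn v (scale a c) = scale a (jn v c).
Proof. by apply/ffunP=> S; rewrite !ffunE; case: ifP; rewrite ?mulr0 // mulrCA. Qed.

(** The boundary is interior multiplication by the sum of all vertices, so its identities reduce to
    the anticommutation rules of [lk] and [jn]. *)
Lemma boundaryE c : boundary c = \sum_v lk v c.
Proof.
apply/ffunP=> S; rewrite !ffunE sum_ffunE big_mkcond /=; apply: eq_bigr => v _.
by rewrite ffunE; case: (v \in S).
Qed.

Lemma boundary_is_zmod : zmod_morphism (@boundary V k).
Proof.
move=> b c; rewrite !boundaryE -sumrB; apply: eq_bigr => v _; exact: raddfB.
Qed.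
HB.instance Definition _ :=
  GRing.isZmodMorphism.Build chain chain (@boundary V k) boundary_is_zmod.

Lemma boundary_scale a c : boundary (scale a c) = scale a (boundary c).
Proof.
apply/ffunP=> S; rewrite !ffunE mulr_sumr; apply: eq_bigr => v _.
by rewrite ffunE mulrCA.
Qed.

Lemma lk_lk v w c : lk v (lk w c) = - lk w (lk v c).
Proof.
apply/ffunP=> S; rewrite !ffunE !in_setU1.
have [->|vw] := eqVneq v w.
  by case: ifP; rewrite ?mulr0 oppr0.
rewrite /=; case: (boolP (v \in S)) => vS; case: (boolP (w \in S)) => wS;
  rewrite ?mulr0 ?oppr0 //=.
rewrite eq_sym in vw.
rewrite !sgnU1 // (setUCA [set v]) (sign_rank vw); ring.
Qed.

Lemma lk_lk0 v c : lk v (lk v c) = 0.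
Proof. by apply/ffunP=> S; rewrite !ffunE !in_setU1 eqxx /= mulr0 if_same. Qed.

Lemma lk_jn_id v c : lk v (jn v c) = c - jn v (lk v c).
Proof.
apply/ffunP=> S; rewrite !ffunE in_setU1 eqxx in_setD1 eqxx /=.
have [vS|vS] := boolP (v \in S).
  by rewrite sgnD1_id mulrA sgnK setD1K // mul1r subrr.
by rewrite sgnU1_id mulrA sgnK setU1K // mul1r subr0.
Qed.

Lemma lk_jn v w c : v != w -> lk v (jn w c) = - jn w (lk v c).
Proof.
move=> vw; apply/ffunP=> S; rewrite !ffunE in_setU1 in_setD1.
rewrite [w == v]eq_sym (negPf vw) /=.
have [vS|vS] := boolP (v \in S); have [wS|wS] := boolP (w \in S);
  rewrite ?mulr0 ?oppr0 //=.
have -> : (v |: S) :\ w = v |: (S :\ w).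
  by rewrite setDUl; congr (_ :|: _); apply/setDidPl; rewrite disjoints1 inE.
rewrite -{1}(setD1K wS) !sgnU1 ?inE ?eqxx // (sign_rank vw).
rewrite -[RHS]mul1r -[in RHS](sqrr_sign k (enum_rank v < enum_rank w)%N); ring.
Qed.

Lemma boundary_lk v c : boundary (lk v c) = - lk v (boundary c).
Proof.
rewrite !boundaryE raddf_sum -sumrN; apply: eq_bigr => w _; exact: lk_lk.
Qed.

Lemma boundary_jn v c : boundary (jn v c) = c - jn v (boundary c).
Proof.
rewrite !boundaryE raddf_sum (bigD1 v) //= lk_jn_id.
rewrite [in RHS](bigD1 v) //= opprD addrA; congr (_ + _).
by rewrite -sumrN; apply: eq_bigr => w wv; rewrite lk_jn.
Qed.

Lemma boundary_boundary c : boundary (boundary c) = 0.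
Proof.
rewrite boundaryE [boundary c]boundaryE.
under eq_bigr do rewrite raddf_sum /=.
(* Antisymmetry of the summand alone gives only that twice the sum is 0, which says nothing in
   characteristic 2. Splitting by the order of v and w pairs the terms off. *)
have -> : \sum_v \sum_w lk v (lk w c) =
   \sum_v \sum_(w | (enum_rank v < enum_rank w)%N) lk v (lk w c) +
   \sum_v \sum_(w | (enum_rank w < enum_rank v)%N) lk v (lk w c).
  rewrite -big_split; apply: eq_bigr => v _ /=.
  rewrite (bigD1 v) //= lk_lk0 add0r.
  rewrite (bigID (fun w => enum_rank v < enum_rank w)%N) /=.
  congr (_ + _); apply: eq_bigl => w.
    by have [->|//] := eqVneq w v; rewrite ltnn.
  have [->|wv] := eqVneq w v; first by rewrite ltnn.
  rewrite -leqNgt leq_eqVlt /=; case: eqP => // /val_inj /enum_rank_inj E.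
  by rewrite E eqxx in wv.
rewrite [X in _ + X](exchange_big_dep predT) //= -big_split /=.
rewrite big1 // => v _; rewrite -big_split big1 // => w _.
by rewrite /= lk_lk addNr.
Qed.

End Chains.

(** * Vectors of minimal support in a linear space *)

Section MinimalVectors.
Variables (I : finType) (k : fieldType).
Implicit Types (x y z e w : {ffun I -> k}) (i : I) (Q : {set I}).

Definition supp x : {set I} := [set i | x i != 0].

Lemma supp_neq0 x i : i \in supp x -> x != 0.
Proof. by rewrite inE; apply: contraNneq => ->; rewrite ffunE. Qed.

Lemma supp_ex x : x != 0 -> exists i, i \in supp x.
Proof.
move=> x0; apply/set0Pn; apply: contraNneq x0 => sx; apply/eqP/ffunP=> i.
by rewrite ffunE; apply/eqP; have := in_set0 i; rewrite -sx inE => /negbFE.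
Qed.

Lemma suppB x y : supp (x - y) \subset supp x :|: supp y.
Proof.
apply/subsetP=> i; rewrite !inE !ffunE.
by have [->|//] := eqVneq (x i) 0; have [->|//] := eqVneq (y i) 0; rewrite subrr eqxx.
Qed.

Definition lincomb_closed (L : {ffun I -> k} -> Prop) :=
  forall a x y, L x -> L y -> L (x - [ffun i => a * y i]).

Definition minimal (L : {ffun I -> k} -> Prop) e :=
  [/\ L e, e != 0 &
      forall z, L z -> z != 0 -> supp z \subset supp e -> supp z = supp e].

Variable L : {ffun I -> k} -> Prop.
Hypothesis closedL : lincomb_closed L.

Let kill i x y : {ffun I -> k} := x - [ffun j => x i / y i * y j].

Let L_kill i x y : L x -> L y -> L (kill i x y).
Proof. exact: closedL. Qed.

Let supp_kill i x y : i \in supp y -> supp y \subset supp x ->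
  supp (kill i x y) \proper supp x.
Proof.
rewrite inE => yi /subsetP yx; apply/properP; split.
  apply/subsetP=> j; rewrite !inE !ffunE; apply: contraNneq => xj.
  have /eqP-> : y j == 0 by apply: contraT => yj; have := yx j; rewrite !inE yj xj eqxx => /(_ isT).
  by rewrite xj mulr0 subrr.
by exists i; rewrite ?yx ?inE // !ffunE divfK // subrr eqxx.
Qed.

(** Induction on the support. If [w] is not minimal, some [z] has a strictly smaller one. Either [z]
    contains [i], or a multiple of [z] removes another point from [w] and leaves the coordinate [i]
    unchanged. *)
Lemma minimal_through w i : L w -> i \in supp w ->
  exists e, [/\ minimal L e, supp e \subset supp w & i \in supp e].
Proof.
have [n] := ubnP #|supp w|; elim: n w => // n IHn w /ltnSE le_n Lw wi.
have IH w' : L w' -> i \in supp w' -> supp w' \proper supp w ->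
    exists e, [/\ minimal L e, supp e \subset supp w & i \in supp e].
  move=> Lw' w'i w'w; have [|//|//|e [? ew' ?]] := IHn w'.
    exact: leq_trans (proper_card w'w) le_n.
  by exists e; split=> //; apply: subset_trans ew' (proper_sub w'w).
have [[z [Lz z0 zw]]|nz] :=
    pselect (exists z, [/\ L z, z != 0 & supp z \proper supp w]).
  have [zi|zi] := boolP (i \in supp z); first exact: (IH z).
  have [j zj] := supp_ex z0.
  apply: (IH (kill j w z)).
  - exact: L_kill.
  - move: zi wi; rewrite !inE negbK !ffunE => /eqP->.
    by rewrite mulr0 subr0.
  - exact/supp_kill/proper_sub.
exists w; split=> //; split=> //; first exact: supp_neq0 wi.
move=> z Lz z0; rewrite subEproper => /orP[/eqP//|zw].
by case: nz; exists z.
Qed.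

(** In matroid terms [Q] is a separator. Minimal vectors are peeled off [w] one at a time; each lies
    inside [Q] or misses it, so the restriction to [Q] changes by a multiple of that vector or not
    at all. *)
Lemma restrict_to_minimal_union Q w : L w ->
  (forall e i j, minimal L e -> supp e \subset supp w ->
     i \in supp e -> j \in supp e -> i \in Q -> j \in Q) ->
  L [ffun i => if i \in Q then w i else 0].
Proof.
have [n] := ubnP #|supp w|; elim: n w => // n IHn w /ltnSE le_n Lw Qw.
have [/existsP[i wi]|w0] := boolP [exists i, i \in supp w]; last first.
  have {}w0 i : w i = 0.
    move: w0; rewrite negb_exists => /forallP/(_ i).
    by rewrite inE negbK => /eqP.
  suff -> : [ffun i => if i \in Q then w i else 0] = w by [].
  by apply/ffunP=> i; rewrite ffunE w0 if_same.
have [e [me ew ei]] := minimal_through Lw wi.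
have [Le _ _] := me.
have kw : supp (kill i w e) \proper supp w by exact: supp_kill.
have := IHn (kill i w e) (leq_trans (proper_card kw) le_n) (L_kill i Lw Le).
move=> Lk; have {Lk} : L [ffun j => if j \in Q then kill i w e j else 0].
  apply: Lk => e' j j' me' e'k; apply: (Qw e') => //.
  exact: subset_trans e'k (proper_sub kw).
move=> Lk; have [iQ|iQ] := boolP (i \in Q).
  have -> : [ffun i => if i \in Q then w i else 0]
      = [ffun j => if j \in Q then kill i w e j else 0]
        - [ffun j => - (w i / e i) * e j].
    apply/ffunP=> j; rewrite !ffunE; case: ifP => jQ.
      by rewrite mulNr opprK subrK.
    have /eqP-> : e j == 0.
      apply: contraFT jQ => ej; apply: (Qw e i j) => //; by rewrite inE.
    by rewrite mulr0 subr0.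
  exact: closedL.
suff -> : [ffun i => if i \in Q then w i else 0]
    = [ffun j => if j \in Q then kill i w e j else 0] by [].
apply/ffunP=> j; rewrite !ffunE; case: ifP => // jQ.
have /eqP-> : e j == 0.
  apply: contraT => ej; case/negP: iQ; apply: (Qw e j i) => //; by rewrite inE.
by rewrite mulr0 subr0.
Qed.

End MinimalVectors.

Section Cycles.
Variables (V : finType) (k : fieldType).
Notation chain := {ffun {set V} -> k}.
Implicit Types (u v w x : V) (S T : {set V}) (c : chain) (n : nat).

(** Chains are graded by the size of their simplices, one more than the dimension. *)
Definition uniform n c := {in supp c, forall S, #|S| = n}.

Definition uniform_cycle n c := boundary c = 0 /\ uniform n c.

Lemma uniformB n c c' : uniform n c -> uniform n c' -> uniform n (c - c').
Proof.
by move=> uc uc' S /(subsetP (suppB _ _)); rewrite inE => /orP[/uc|/uc'].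
Qed.

Lemma uniformN n c : uniform n c -> uniform n (- c).
Proof. by move=> uc S; rewrite inE ffunE oppr_eq0 => Sc; rewrite uc ?inE. Qed.

Lemma uniform_scale n a c : uniform n c -> uniform n (scale a c).
Proof.
by move=> uc S; rewrite inE ffunE mulf_eq0 => /norP[_ Sc]; rewrite uc ?inE.
Qed.

Lemma uniform_lk n v c : uniform n.+1 c -> uniform n (lk v c).
Proof.
move=> uc S; rewrite inE ffunE; case: ifP => [|vS]; first by rewrite eqxx.
rewrite mulf_eq0 => /norP[_ Sc]; have := uc (v |: S); rewrite inE Sc cardsU1 vS.
by move=> /(_ isT)[].
Qed.

Lemma uniform_jn n v c : uniform n c -> uniform n.+1 (jn v c).
Proof.
move=> uc S; rewrite inE ffunE; case: ifP => [vS|]; last by rewrite eqxx.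
rewrite mulf_eq0 => /norP[_ Sc]; have := uc (S :\ v).
by rewrite inE (cardsD1 v S) vS => ->.
Qed.

Lemma uniform_boundary n c : uniform n.+1 c -> uniform n (boundary c).
Proof.
move=> uc S; rewrite inE boundaryE sum_ffunE => nz.
have [v Sv] : exists v, S \in supp (lk v c).
  apply/existsP; apply: contraNT nz; rewrite negb_exists => /forallP cS.
  by rewrite big1 // => v _; apply/eqP; have := cS v; rewrite inE negbK.
exact: uniform_lk Sv.
Qed.

Lemma cycle_lincomb n : lincomb_closed (uniform_cycle n).
Proof.
move=> a x y [bx ux] [yx uy]; split; last exact/uniformB/uniform_scale.
by rewrite raddfB /= bx (boundary_scale a y) yx /scale; apply/ffunP=> S; rewrite !ffunE mulr0 subr0.
Qed.

(** The term of [T] in the boundary coefficient at the ridge [T :\ v] must be cancelled by another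
    simplex over that ridge. *)
Lemma cycle_exchange n c T v : uniform_cycle n c -> T \in supp c -> v \in T ->
  exists2 x, x \notin T & x |: (T :\ v) \in supp c.
Proof.
move=> [bc _]; rewrite inE => Tc vT.
case: (pselect (exists2 x, x \notin T & x |: (T :\ v) \in supp c)) => // nx.
have := congr1 (fun c => c (T :\ v)) bc; rewrite !ffunE.
rewrite (bigD1 v) ?inE ?eqxx //= big1 ?addr0 => [|x].
  move/eqP; rewrite mulf_eq0 setD1K // (negPf Tc) orbF.
  by rewrite signr_eq0.
rewrite !inE => /andP[xT xv]; rewrite xv /= in xT.
have : x |: (T :\ v) \notin supp c by apply/negP=> ?; apply: nx; exists x.
by rewrite inE negbK => /eqP->; rewrite mulr0.
Qed.

End Cycles.

(** * Contraction of an edge *)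

Section Contraction.
Variables (V : finType) (k : fieldType) (u v : V).
Hypothesis uv : u != v.
Notation chain := {ffun {set V} -> k}.
Implicit Types (w x : V) (S T : {set V}) (c : chain) (n : nat).

Definition fold S := if v \in S then u |: (S :\ v) else S.

(* Write c = c0 + v c1; the chain map sends it to c0 + u c1. *)
Definition contract c : chain := c - (jn v (lk v c) - jn u (lk v c)).

Lemma contract_is_zmod : zmod_morphism contract.
Proof.
by move=> b c; rewrite /contract !raddfB /=; apply/ffunP=> S; rewrite !ffunE; ring.
Qed.
HB.instance Definition _ :=
  GRing.isZmodMorphism.Build chain chain contract contract_is_zmod.

Lemma contract_scale a c : contract (scale a c) = scale a (contract c).
Proof.
rewrite /contract lk_scale !jn_scale; apply/ffunP=> S; rewrite !ffunE; ring.
Qed.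

Lemma contractE c S : contract c S =
  if v \in S then 0
  else c S + if u \in S then sgn k u S * (sgn k v (S :\ u) * c (v |: (S :\ u))) else 0.
Proof.
rewrite !ffunE; have [vS|vS] := boolP (v \in S).
  rewrite !inE eqxx vS [v == u]eq_sym uv /= mulr0 if_same subr0.
  by rewrite sgnD1_id mulrA sgnK mul1r setD1K // subrr.
by rewrite sub0r opprK !inE (negPf vS) andbF.
Qed.

Lemma boundary_contract c : boundary (contract c) = contract (boundary c).
Proof.
rewrite /contract !raddfB /= !boundary_jn boundary_lk !raddfN /=; apply/ffunP=> S.
rewrite !ffunE; ring.
Qed.

(** Weights constant on the fibres of [fold] pass through the contraction. This lifts a chain
    supported in the contraction of [c] back to one supported in [c], and so transfers
    minimality. *)
Lemma contract_mul c (g : {set V} -> k) :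
  contract [ffun S => c S * g (fold S)] = [ffun S => contract c S * g S].
Proof.
apply/ffunP=> S; rewrite contractE [RHS]ffunE contractE !ffunE.
case: (boolP (v \in S)) => vS; first by rewrite mul0r.
rewrite {1}/fold (negPf vS); case: ifP => uS; last by rewrite !addr0.
have -> : fold (v |: (S :\ u)) = S.
  by rewrite /fold setU11 setU1K ?setD1K // inE (negPf vS) andbF.
ring.
Qed.

Lemma uniform_contract n c : uniform n.+1 c -> uniform n.+1 (contract c).
Proof.
move=> uc; apply: uniformB => //.
by apply: uniformB; apply: uniform_jn; apply: uniform_lk.
Qed.

(* The correction by sets containing both u and v that turns c into a cycle
   as soon as its contraction is one. *)
Definition closing c : chain := c + jn u (jn v (boundary (lk v c))).

(** The closing and the contraction are homologous: they differ by the boundary of the prism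
    [jn u (jn v (lk v c))]. *)
Lemma boundary_closing c : boundary (contract c) = 0 -> boundary (closing c) = 0.
Proof.
move=> bc; have -> : closing c = contract c + boundary (jn u (jn v (lk v c))).
  rewrite /closing /contract !boundary_jn !raddfB /=; apply/ffunP=> S.
  rewrite !ffunE; ring.
by rewrite raddfD /= bc boundary_boundary addr0.
Qed.

Lemma closing_off c S : ~~ ((u \in S) && (v \in S)) -> closing c S = c S.
Proof.
rewrite !ffunE !inE [v == u]eq_sym uv /=.
by case: (u \in S) => //=; case: (v \in S) => //=; rewrite ?mulr0 addr0.
Qed.

Lemma uniform_closing n c : uniform n.+2 c -> uniform n.+2 (closing c).
Proof.
move=> uc; rewrite /closing -[X in c + X]opprK; apply/uniformB/uniformN => //.
by do 2!apply: uniform_jn; apply: uniform_boundary; apply: uniform_lk.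
Qed.

End Contraction.

(** * Infinitesimal and generic rigidity *)

Section MatrixPerturbation.
Variable R : realType.

(** With a right inverse [N] of [M0], the determinant of [(M0 + t M1) N] is a polynomial in [t] with
    value 1 at 0. *)
Lemma row_free_pencil p q (M0 M1 : 'M[R]_(p, q)) : row_free M0 ->
  exists2 P : {poly R}, P != 0 & forall t, P.[t] != 0 -> row_free (M0 + t *: M1).
Proof.
move=> /row_freeP[N M0N].
pose P := \det (map_mx polyC (M0 *m N) + 'X *: map_mx polyC (M1 *m N)).
have PE t : P.[t] = \det ((M0 + t *: M1) *m N).
  rewrite -[P.[t]]/(horner_eval t P) -det_map_mx; congr (\det _).
  apply/matrixP=> i j; rewrite mulmxDl -scalemxAl.
  by rewrite !mxE /= /horner_eval !hornerE.
exists P => [|t].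
  apply/eqP=> P0; have := PE 0; rewrite P0 horner0 scale0r addr0 M0N det1.
  by move/eqP; rewrite eq_sym oner_eq0.
rewrite PE -unitfE -unitmxE => uMN; apply: inj_row_free => r rM.
by apply: (row_free_inj (A := (M0 + t *: M1) *m N)); rewrite ?row_free_unit // mulmxA rM !mul0mx.
Qed.

(** If [r M = 0] then [r = - r (M - M0) N] for a right inverse [N] of [M0]. The right side has l1
    norm at most [K / (K + 1)] times that of [r], so [r = 0]. *)
Lemma row_free_near p q (M0 : 'M[R]_(p, q)) : row_free M0 ->
  exists2 e : R, 0 < e &
    forall M : 'M_(p, q), (forall i j, `|M i j - M0 i j| <= e) -> row_free M.
Proof.
move=> /row_freeP[N M0N]; pose K := \sum_i \sum_j `|N i j|.
have K0 : 0 <= K by do 2!apply: sumr_ge0 => ? _.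
exists (K + 1)^-1 => [|M MM0]; first by rewrite invr_gt0 ltr_wpDl.
apply: inj_row_free => r rM; pose E := (M - M0) *m N.
have rE : r = - (r *m E).
  by rewrite mulmxA mulmxBr rM sub0r mulNmx opprK -mulmxA M0N mulmx1.
have le_E j : \sum_i `|E j i| <= (K + 1)^-1 * K.
  apply: (@le_trans _ _ (\sum_i \sum_l (K + 1)^-1 * `|N l i|)).
    apply: ler_sum => i _; rewrite mxE (le_trans (ler_norm_sum _ _ _)) //.
    apply: ler_sum => l _; rewrite normrM ler_wpM2r //.
    by rewrite !mxE MM0.
  rewrite /K exchange_big mulr_sumr; apply: ler_sum => i _.
  by rewrite mulr_sumr.
have : \sum_i `|r 0 i| <= (K + 1)^-1 * K * \sum_i `|r 0 i|.
  rewrite {1}rE (@le_trans _ _ (\sum_i \sum_j `|r 0 j| * `|E j i|)) //.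
    apply: ler_sum => i _; rewrite 2!mxE normrN (le_trans (ler_norm_sum _ _ _)) //.
    by apply: ler_sum => j _; rewrite normrM.
  rewrite exchange_big mulr_sumr; apply: ler_sum => j _.
  by rewrite -mulr_sumr mulrC ler_wpM2r.
rewrite mulrAC -mulrA [_ * K]mulrC ler_pdivlMl ?ltr_wpDl // mulrDl mul1r gerDl.
rewrite le_eqVlt ltNge sumr_ge0 //= orbF psumr_eq0 // => /allP r0.
apply/rowP=> i; rewrite mxE; apply/eqP; rewrite -normr_eq0.
exact: r0 (mem_index_enum i).
Qed.

Section Systems.
Variables P Q : finType.
Implicit Types (c : P -> Q -> R).

Definition injective_system c := forall r : P -> R,
  (forall q, \sum_p r p * c p q = 0) -> forall p, r p = 0.

Definition system_mx c := \matrix_(i < #|P|, j < #|Q|) c (enum_val i) (enum_val j).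

Lemma injective_systemP c : row_free (system_mx c) <-> injective_system c.
Proof.
split=> [fM r rc p|ic].
  have : (\row_i r (enum_val i)) *m system_mx c = 0 *m system_mx c.
    apply/rowP=> j; rewrite mul0mx !mxE -[RHS](rc (enum_val j)).
    rewrite [RHS](reindex _ (onW_bij _ (enum_val_bij P))) /=.
    by apply: eq_bigr => i _; rewrite !mxE.
  move/(row_free_inj fM)/rowP/(_ (enum_rank p)).
  by rewrite !mxE enum_rankK.
apply: inj_row_free => r rM; apply/rowP=> i; rewrite mxE.
have := ic (fun p => r 0 (enum_rank p)) _ (enum_val i); rewrite enum_valK; apply.
move=> q; have /rowP/(_ (enum_rank q)) := rM; rewrite !mxE => rq; rewrite -[RHS]rq.
rewrite [LHS](reindex _ (onW_bij _ (enum_val_bij P))) /=.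
by apply: eq_bigr => j _; rewrite !mxE enum_valK enum_rankK.
Qed.

Lemma injective_system_pencil c0 c1 : injective_system c0 ->
  exists2 P : {poly R}, P != 0 &
    forall t, P.[t] != 0 -> injective_system (fun p q => c0 p q + t * c1 p q).
Proof.
move=> /injective_systemP f0; have [S S0 fS] := row_free_pencil (system_mx c1) f0.
exists S => // t /fS ft; apply/injective_systemP.
have -> // : system_mx (fun p q => c0 p q + t * c1 p q) = system_mx c0 + t *: system_mx c1.
by apply/matrixP=> i j; rewrite !mxE.
Qed.

Lemma injective_system_near c0 : injective_system c0 ->
  exists2 e : R, 0 < e &
    forall c, (forall p q, `|c p q - c0 p q| <= e) -> injective_system c.
Proof.
move=> /injective_systemP/row_free_near[e e0 near_e]; exists e => // c cc0.
by apply/injective_systemP/near_e => i j; rewrite !mxE.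
Qed.

End Systems.
End MatrixPerturbation.

(** * Infinitesimal motions of frameworks *)

Section Frameworks.
Variables (R : realType) (d : nat) (V : finType).
Notation config := (V -> 'rV[R]_d).
Implicit Types (x y z : V) (F W S : {set V}) (X : {set {set V}}).
Implicit Types (h m f g : config) (a b : 'rV[R]_d) (A : 'M[R]_d).

Definition dot a b : R := \sum_(i < d) a 0 i * b 0 i.

Lemma dotE a b : dot a b = (a *m b^T) 0 0.
Proof. by rewrite mxE; apply: eq_bigr => i _; rewrite mxE. Qed.

Lemma dotC a b : dot a b = dot b a.
Proof. by apply: eq_bigr => i _; rewrite mulrC. Qed.

Lemma dotDl a b c : dot (a + b) c = dot a c + dot b c.
Proof. by rewrite !dotE mulmxDl mxE. Qed.

Lemma dotBl a b c : dot (a - b) c = dot a c - dot b c.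
Proof. by rewrite !dotE mulmxBl !mxE. Qed.

Lemma dotBr a b c : dot a (b - c) = dot a b - dot a c.
Proof. by rewrite !(dotC a) dotBl. Qed.

Lemma dotZr (t : R) a b : dot a (t *: b) = t * dot a b.
Proof. by rewrite !dotE linearZ /= -scalemxAr mxE. Qed.

Lemma dot0l a : dot 0 a = 0.
Proof. by rewrite dotE mul0mx mxE. Qed.

Lemma dot_eq0 a : dot a a = 0 -> a = 0.
Proof.
move=> /eqP; rewrite psumr_eq0 => [/allP a0|i _]; last by rewrite -expr2 sqr_ge0.
apply/rowP=> i; rewrite mxE; apply/eqP; rewrite -sqrf_eq0 expr2.
exact: a0 (mem_index_enum i).
Qed.

Lemma antisym_dot A a b : A^T = - A -> dot (a *m A) b = - dot (b *m A) a.
Proof.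
move=> aA; rewrite !dotE -[a *m A *m b^T]trmxK mxE !trmx_mul trmxK aA.
by rewrite mulNmx mulmxN mxE mulmxA.
Qed.

Lemma antisym_dot_id A a : A^T = - A -> dot (a *m A) a = 0.
Proof.
move=> /(antisym_dot a a) /eqP; rewrite eq_sym -subr_eq0 -opprD oppr_eq0.
by rewrite -mulr2n mulrn_eq0 => /eqP.
Qed.

Definition flex X h m :=
  forall S, S \in X -> {in S &, forall x y, dot (m x - m y) (h x - h y) = 0}.

Definition rigid_motion A b h m x := m x = h x *m A + b.

Definition trivial W h m :=
  exists A b, A^T = - A /\ {in W, forall x, rigid_motion A b h m x}.

Definition rigid_at X h := forall m, flex X h m -> trivial (cover X) h m.

(** Linear rather than affine independence: it makes the matrix of [d] points invertible and still
    holds generically. *)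
Definition indep F h := row_free (\matrix_(i < #|F|) h (enum_val i)).

Lemma enum_val_surj F x : x \in F -> exists i : 'I_#|F|, x = enum_val i.
Proof. by move=> xF; exists (enum_rank_in xF x); rewrite enum_rankK_in. Qed.

Lemma indep_inv F h : #|F| = d -> indep F h ->
  exists B, (\matrix_(i < #|F|) h (enum_val i)) *m B = 1%:M /\
            B *m (\matrix_(i < #|F|) h (enum_val i)) = 1%:M.
Proof.
move=> Fd; rewrite /indep; move: (\matrix_i _) => H.
by case: _ / (esym Fd) H => H; rewrite row_free_unit => uH; exists (invmx H); rewrite mulmxV ?mulVmx.
Qed.

Let row_const1 p (i : 'I_p) : row i (const_mx 1 : 'cV[R]_p) = 1%:M.
Proof. by apply/rowP=> j; rewrite !mxE (ord1 j). Qed.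

(* With H the matrix of the points and s x = dot (m x) (h x), the translation
   must satisfy H b^T = s; then A = H^-1 (M - 1 b) is antisymmetric because
   dot (m x) (h y) + dot (m y) (h x) = s x + s y. *)
Lemma simplex_trivial F h m : #|F| = d -> indep F h ->
  {in F &, forall x y, dot (m x - m y) (h x - h y) = 0} -> trivial F h m.
Proof.
move=> Fd iF mF; have [B [HB BH]] := indep_inv Fd iF.
pose H := \matrix_(i < #|F|) h (enum_val i); rewrite -/H in HB BH.
pose M := \matrix_(i < #|F|) m (enum_val i).
pose s : 'cV_#|F| := \col_i dot (m (enum_val i)) (h (enum_val i)).
have [b bH] : exists b : 'rV_d, H *m b^T = s.
  by exists (B *m s)^T; rewrite trmxK mulmxA HB mul1mx.
pose one : 'cV[R]_#|F| := const_mx 1.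
have [A HA] : exists A : 'M_d, H *m A = M - one *m b.
  by exists (B *m (M - one *m b)); rewrite mulmxA HB mul1mx.
exists A, b; split; last first.
  move=> x /enum_val_surj[i ->]; rewrite /rigid_motion; have /(congr1 (row i)) := HA.
  rewrite linearB /= !row_mul !rowK => ->.
  by rewrite row_const1 mul1mx subrK.
have HS : H *m (A^T + A) *m H^T = 0.
  have -> : H *m (A^T + A) *m H^T = H *m (H *m A)^T + (H *m A) *m H^T.
    by rewrite mulmxDr mulmxDl trmx_mul !mulmxA.
  rewrite HA; apply/matrixP=> i j; rewrite linearB /= trmx_mul mulmxBr mulmxBl.
  have -> : one *m b *m H^T = one *m s^T by rewrite -mulmxA -bH trmx_mul trmxK.
  rewrite mulmxA bH.
  rewrite !mxE !big_ord1 !mxE mulr1.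
  have := mF _ _ (enum_valP i) (enum_valP j).
  rewrite !dotBl !dotBr.
  have E i' j' : \sum_l H i' l * M^T l j' = dot (m (enum_val j')) (h (enum_val i')).
    by apply: eq_bigr => l _; rewrite !mxE mulrC.
  have E' i' j' : \sum_l M i' l * H^T l j' = dot (m (enum_val i')) (h (enum_val j')).
    by apply: eq_bigr => l _; rewrite !mxE.
  rewrite E E'; lra.
have : B *m (H *m (A^T + A) *m H^T) *m B^T = 0 by rewrite HS mulmx0 mul0mx.
rewrite !mulmxA BH mul1mx -mulmxA -trmx_mul BH trmx1 mulmx1 => /eqP.
by rewrite addr_eq0 => /eqP.
Qed.

(** On [d] independent points the two motions can only differ by [C = w e], an antisymmetric matrix
    of rank at most 1. Its quadratic form vanishes; if [w] is nonzero, its values at [w^T] and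
    [w^T + e] force [e = 0], and then [C = 0]. *)
Lemma rigid_motion_inj F h m A b A' b' : #|F| = d -> indep F h ->
  A^T = - A -> A'^T = - A' ->
  {in F, forall x, rigid_motion A b h m x} ->
  {in F, forall x, rigid_motion A' b' h m x} -> A = A' /\ b = b'.
Proof.
move=> Fd iF aA aA' mA mA'; have [B [HB BH]] := indep_inv Fd iF.
set H := \matrix_(i < #|F|) h (enum_val i) in HB BH.
pose C := A - A'; pose e := b - b'.
have aC : C^T = - C by rewrite linearB /= aA aA' opprK /C opprB addrC.
have Ce x : x \in F -> h x *m C = - e.
  move=> xF; have := mA' x xF; rewrite /rigid_motion (mA x xF) => E.
  rewrite mulmxBr (canRL (addrK b) E) -[_ + b' - b]addrA.
  by rewrite [LHS]addrC addKr opprB.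
pose w := - (B *m const_mx 1) : 'cV[R]_d.
have Cw : C = w *m e.
  rewrite -[C]mul1mx -BH -mulmxA mulNmx -mulmxN -mulmxA; congr (_ *m _).
  apply/row_matrixP=> i; rewrite !row_mul rowK Ce ?enum_valP //.
  by rewrite row_const1 mul1mx.
have e0 : e = 0.
  have dotC0 a : dot a w^T * dot e a = 0.
    rewrite -[RHS](antisym_dot_id a aC) Cw !dotE trmxK mulmxA -mulmxA.
    by rewrite [RHS]mxE big_ord1.
  have [w0|w0] := eqVneq (dot w^T w^T) 0.
    have {}w0 : w = 0 by rewrite -[w]trmxK (dot_eq0 w0) trmx0.
    have HC : C = 0 by rewrite Cw w0 mul0mx.
    have [F0|[x xF]] := set_0Vmem F.
      apply/rowP=> i; have : (i < 0)%N by rewrite -(cards0 V) -F0 Fd.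
      by rewrite ltn0.
    by have := Ce x xF; rewrite HC mulmx0 => /eqP; rewrite eq_sym oppr_eq0 => /eqP.
  have ew : dot e w^T = 0.
    by have /eqP := dotC0 w^T; rewrite mulf_eq0 (negPf w0) => /eqP.
  have := dotC0 (w^T + e); rewrite dotDl ew addr0 dotC dotDl dotC ew add0r => /eqP.
  by rewrite mulf_eq0 (negPf w0) => /eqP/dot_eq0.
split; apply/eqP; rewrite -subr_eq0 -/C -/e ?e0 //.
by rewrite Cw e0 mulmx0.
Qed.

(** The gluing principle: a piece that moves trivially and shares [d] independent points with a
    rigid body moves with that body. *)
Lemma rigid_motion_extend F W h m A b : #|F| = d -> indep F h -> A^T = - A ->
  {in F, forall x, rigid_motion A b h m x} -> F \subset W -> trivial W h m ->
  {in W, forall x, rigid_motion A b h m x}.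
Proof.
move=> Fd iF aA mF FW [A' [b' [aA' mW]]].
have [-> ->] // := rigid_motion_inj Fd iF aA aA' mF (sub_in1 (subsetP FW) mW).
Qed.

Lemma trivial_flex_dot W h m : trivial W h m ->
  {in W &, forall x y, dot (m x - m y) (h x - h y) = 0}.
Proof.
move=> [A [b [aA mW]]] x y xW yW; rewrite (mW x xW) (mW y yW).
by rewrite opprD addrACA subrr addr0 -mulmxBl antisym_dot_id.
Qed.

End Frameworks.

(** * Generic configurations and pinned frameworks *)

Section Genericity.
Variables (R : realType) (d : nat) (V : finType).
Notation config := (V -> 'rV[R]_d).
Implicit Types (x y z : V) (F W S : {set V}) (X : {set {set V}}).
Implicit Types (h m f g : config) (A B : config -> Prop) (P Q : {poly R}).

Lemma small_nonroot P (e : R) : P != 0 -> 0 < e ->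
  exists t, [/\ 0 < t, t < e & P.[t] != 0].
Proof.
(* These are [size P] distinct points, more than [P] has roots. The denominators start at 2 to keep
   the points strictly below [e]. *)
move=> P0 e0; pose s := [seq e / n.+2%:R | n <- iota 0 (size P)].
have [/allP rs|/allPn[t /mapP[n _ ->] nr]] := boolP (all (root P) s); last first.
  exists (e / n.+2%:R); split=> //; first by rewrite divr_gt0.
  by rewrite gtr_pMr // invf_lt1 // ltr1n.
have := max_poly_roots P0 (introT allP rs).
rewrite size_map size_iota ltnn; case/(_ _)/notF => //.
rewrite map_inj_uniq ?iota_uniq // => i j /(mulfI (lt0r_neq0 e0)).
by move/invr_inj/eqP; rewrite eqr_nat => /eqP[].
Qed.

Lemma flip_neq0 P : P != 0 -> P \Po (1 - 'X) != 0.
Proof.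
move=> P0; rewrite -size_poly_eq0 size_comp_poly2 ?size_poly_eq0 //.
by rewrite -opprB size_polyN size_XsubC.
Qed.

Definition line h g (t : R) : config := fun v => h v + t *: (g v - h v).

Definition near_config (e : R) g h := forall v i, `|g v 0 i - h v 0 i| < e.

(** The last clause is density in algebraic form. It involves one parameter only, so no polynomials
    in the coordinates of all points are needed. *)
Definition generic_open B :=
  [/\ exists h, B h,
      forall h, B h -> exists2 e, 0 < e & forall g, near_config e g h -> B g &
      forall h, B h -> forall g,
        exists2 P : {poly R}, P != 0 & forall t, P.[t] != 0 -> B (line h g t)].

Definition generic A := exists2 B, generic_open B & forall h, B h -> A h.

Lemma generic_imp A A' : (forall h, A h -> A' h) -> generic A -> generic A'.
Proof. by move=> AA' [B gB BA]; exists B => // h /BA/AA'. Qed.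

Lemma generic_true A : (forall h, A h) -> generic A.
Proof.
move=> Ah; exists (fun=> True) => //; split=> [|h _|h _ g].
- by exists (fun=> 0).
- by exists 1.
- by exists 1; rewrite ?oner_eq0.
Qed.

Lemma lineC h g t : line h g t = line g h (1 - t).
Proof.
apply/funext=> v; apply/rowP=> i; rewrite !mxE; ring.
Qed.

Lemma generic_and A A' : generic A -> generic A' -> generic (fun h => A h /\ A' h).
Proof.
move=> [B [[h Bh] openB lineB] BA] [B' [[h' Bh'] openB' lineB'] BA'].
exists (fun h => B h /\ B' h) => [|f [/BA ? /BA']//]; split.
(* The line from [h] to [h'] starts in [B] and ends in [B']. A common point avoids the roots of [P]
   read forwards and those of [P'] read backwards. *)
- have [P P0 PB] := lineB h Bh h'; have [P' P'0 PB'] := lineB' h' Bh' h.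
  have PP0 : P * (P' \Po (1 - 'X)) != 0 by rewrite mulf_neq0 ?flip_neq0.
  have [t [_ _]] := small_nonroot PP0 ltr01.
  rewrite hornerM mulf_eq0 horner_comp !hornerE => /norP[Pt P't].
  by exists (line h h' t); split; [exact: PB|rewrite lineC; exact: PB'].
- move=> f [/openB[e e0 eB] /openB'[e' e'0 eB']]; exists (Num.min e e').
    by rewrite lt_min e0.
  move=> g gf; split; [apply: eB|apply: eB'] => v i.
    by have := gf v i; rewrite lt_min => /andP[].
  by have := gf v i; rewrite lt_min => /andP[].
- move=> f [/lineB fB /lineB' fB'] g; move: (fB g) (fB' g) => [P P0 PB] [P' P'0 PB'].
  exists (P * P'); first by rewrite mulf_neq0.
  move=> t; rewrite hornerM mulf_eq0 => /norP[? ?]; split; [exact: PB|exact: PB'].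
Qed.

Lemma generic_forall (I : finType) (A : I -> config -> Prop) :
  (forall i, generic (A i)) -> generic (fun h => forall i, A i h).
Proof.
move=> gA; suff gE : generic (fun h => forall i, i \in enum I -> A i h).
  by apply: generic_imp gE => h Ah i; apply: Ah; rewrite mem_enum.
elim: (enum I) => [|i s IHs]; first exact: generic_true.
apply: generic_imp (generic_and (gA i) IHs) => h [Ai As] j.
by rewrite inE => /predU1P[->//|/As].
Qed.

Definition general_position h := forall F, #|F| = d -> indep F h.

Lemma generic_general_position : generic general_position.
Proof.
apply: generic_forall => F; have [Fd|nFd] := eqVneq #|F| d; last first.
  by apply: generic_true => h; move/eqP: nFd.
suff gF : generic (indep F) by apply: generic_imp gF => h iF _.
exists (indep F) => //; split.
- exists (fun x => \row_j (index x (enum F) == j)%:R).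
  apply: inj_row_free => r rH; apply/rowP=> i.
  have /rowP/(_ (cast_ord Fd i)) := rH; rewrite !mxE => <-.
  rewrite (bigD1 i) //= big1 => [|j ji]; rewrite !mxE /enum_val index_uniq ?enum_uniq -?cardE //=.
    by rewrite eqxx mulr1 addr0.
  by rewrite (inj_eq val_inj) (negPf ji) mulr0.
- move=> h /row_free_near[e e0 near_e]; exists e => // g gh; apply: near_e => i j.
  by rewrite !mxE ltW.
- move=> h iF g; have [P P0 PH] :=
    row_free_pencil (\matrix_(i < #|F|) (g (enum_val i) - h (enum_val i))) iF.
  exists P => // t /PH; rewrite /indep; congr (row_free _).
  by apply/matrixP=> i j; rewrite !mxE.
Qed.

Definition adjacent X x y := [exists S in X, (x \in S) && (y \in S)].

(* Pinning m to 0 on F turns rigidity into injectivity of a linear system, which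
   is an open condition. The direction of an edge is a parameter D x y, instead of
   h x - h y, because in vertex splitting u and v may coincide. *)
Definition pinned_rigid X F (D : V -> V -> 'rV[R]_d) := forall m : config,
  (forall x y, adjacent X x y -> dot (m x - m y) (D x y) = 0) ->
  (forall x, (x \in F) || (x \notin cover X) -> m x = 0) -> forall x, m x = 0.

(** The unknowns are the coordinates of [m]. Columns [inl] are edge equations and columns [inr] pin
    coordinates; the zero columns are empty conditions. Points outside [cover X] are pinned too, as
    no edge holds them. *)
Definition pinned_system X F (D : V -> V -> 'rV[R]_d)
    (p : V * 'I_d) (q : V * V + V * 'I_d) : R :=
  match q with
  | inl (x, y) => if adjacent X x y then ((p.1 == x)%:R - (p.1 == y)%:R) * D x y 0 p.2 else 0
  | inr (x, j) => if (x \in F) || (x \notin cover X) then ((p.1 == x) && (p.2 == j))%:R else 0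
  end.

Lemma pinned_rigidP X F D :
  injective_system (pinned_system X F D) <-> pinned_rigid X F D.
Proof.
have sumV (r : V * 'I_d -> R) x i : \sum_z r (z, i) * (z == x)%:R = r (x, i).
  rewrite (bigD1 x) //= eqxx mulr1 big1 ?addr0 // => z /negPf->.
  by rewrite mulr0.
have edge (r : V * 'I_d -> R) x y : adjacent X x y ->
    \sum_p r p * pinned_system X F D p (inl (x, y)) =
    \sum_i (r (x, i) - r (y, i)) * D x y 0 i.
  move=> xy; transitivity (\sum_z \sum_i r (z, i) * (((z == x)%:R - (z == y)%:R) * D x y 0 i)).
    by rewrite pair_bigA; apply: eq_bigr => -[z i] _; rewrite /= xy.
  rewrite exchange_big; apply: eq_bigr => i _.
  by under eq_bigr do rewrite mulrA mulrBr; rewrite -mulr_suml sumrB !sumV.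
have pin (r : V * 'I_d -> R) x j : (x \in F) || (x \notin cover X) ->
    \sum_p r p * pinned_system X F D p (inr (x, j)) = r (x, j).
  move=> xF; rewrite /= xF (bigD1 (x, j)) //= !eqxx mulr1 big1 ?addr0 // => -[z i] /=.
  by rewrite xpair_eqE => /negPf->; rewrite mulr0.
split=> [inj m mX mF x|pr r rq [x i]].
  apply/rowP=> i; rewrite mxE; apply: (inj (fun p => m p.1 0 p.2) _ (x, i)).
  move=> [[y z]|[y j]].
    have [yz|/negPf nyz] := boolP (adjacent X y z); last first.
      by apply: big1 => p _; rewrite /= nyz mulr0.
    rewrite edge // -[RHS](mX y z yz); apply: eq_bigr => j _.
    by rewrite !mxE.
  have [yF|/negPf nyF] := boolP ((y \in F) || (y \notin cover X)); last first.
    by apply: big1 => p _; rewrite /= nyF mulr0.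
  by rewrite pin //= mF // mxE.
suff /rowP/(_ i) : \row_i r (x, i) = 0 :> 'rV_d by rewrite !mxE.
apply: (pr (fun x => \row_i r (x, i))) => [{}x y xy|{}x xF].
  rewrite -[RHS](rq (inl (x, y))) edge //; apply: eq_bigr => j _.
  by rewrite !mxE.
by apply/rowP=> j; rewrite !mxE -(pin r x j xF) rq.
Qed.

Lemma pinned_rigid_pencil X F D D' : pinned_rigid X F D ->
  exists2 P : {poly R}, P != 0 & forall t, P.[t] != 0 ->
    pinned_rigid X F (fun x y => D x y + t *: D' x y).
Proof.
move=> /pinned_rigidP inj.
(* The system is affine in [D], not linear, because of the pinning columns; they cancel in this
   difference. *)
pose c p q := pinned_system X F (fun x y => D x y + D' x y) p q - pinned_system X F D p q.
have [P P0 injP] := injective_system_pencil c inj; exists P => // t /injP it.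
apply/pinned_rigidP; congr (injective_system _): it; apply/funext=> -[z i]; apply/funext.
by case=> [[x y]|[x j]]; rewrite /c /=; case: ifP => _; rewrite ?mxE; ring.
Qed.

Lemma pinned_rigid_near X F D : pinned_rigid X F D ->
  exists2 e : R, 0 < e & forall D' : V -> V -> 'rV_d, (forall x y i, `|D' x y 0 i - D x y 0 i| <= e) ->
    pinned_rigid X F D'.
Proof.
move=> /pinned_rigidP/injective_system_near[e e0 near_e]; exists e => // D' DD'.
apply/pinned_rigidP/near_e => -[z i] [[x y]|[x j]] /=;
  last by rewrite subrr normr0 ltW.
case: ifP => _; last by rewrite subrr normr0 ltW.
rewrite -mulrBr normrM; apply: le_trans (DD' x y i); rewrite ler_piMl //.
by case: (z == x); case: (z == y); rewrite ?subrr ?subr0 ?sub0r ?normrN ?normr0 ?normr1 ?ler01.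
Qed.

Definition directions h x y := h x - h y.

Lemma generic_pinned_rigid X F : (exists h, pinned_rigid X F (directions h)) ->
  generic (fun h => pinned_rigid X F (directions h)).
Proof.
move=> ex; exists (fun h => pinned_rigid X F (directions h)) => //; split=> // h prh => [|g].
  have [e e0 near_e] := pinned_rigid_near prh.
  exists (e / 2) => [|g gh]; first by rewrite divr_gt0.
  apply: near_e => x y i; rewrite !mxE.
  have := gh x i; have := gh y i; rewrite !ltr_norml ler_norml; lra.
have [P P0 PB] := pinned_rigid_pencil (directions (fun v => g v - h v)) prh.
exists P => // t /PB; congr (pinned_rigid _ _ _); apply/funext=> x; apply/funext=> y.
by apply/rowP=> i; rewrite !mxE; ring.
Qed.

(** A flex agrees on the simplex [F] with some rigid motion; subtracting that motion leaves a pinned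
    flex, which is zero. *)
Lemma pinned_rigid_at X F h : #|F| = d -> indep F h -> F \in X ->
  pinned_rigid X F (directions h) -> rigid_at X h.
Proof.
move=> Fd iF FX pr m fm.
have [A [b [aA mF]]] := simplex_trivial Fd iF (fm F FX).
exists A, b; split=> // x xX; rewrite /rigid_motion.
pose m' x := if x \in cover X then m x - (h x *m A + b) else 0.
suff: m' x = 0 by rewrite /m' xX => /eqP; rewrite subr_eq0 => /eqP.
have cov S y : S \in X -> y \in S -> y \in cover X.
  by move=> SX yS; apply/bigcupP; exists S.
apply: pr => [y z /existsP[S /and3P[SX yS zS]]|y].
  rewrite /m' !(cov S) //.
  have -> : m y - (h y *m A + b) - (m z - (h z *m A + b)) =
      (m y - m z) - (h y - h z) *m A.
    by rewrite mulmxBl; apply/rowP=> i; rewrite !mxE; ring.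
  by rewrite dotBl (fm S) // /directions antisym_dot_id // subr0.
rewrite /m'; case: ifP => //= yX; rewrite orbF => yF.
by rewrite (mF y yF) subrr.
Qed.

End Genericity.

(** * Vertex splitting *)

Section VertexSplitting.
Variables (R : realType) (d : nat) (V : finType).
Notation config := (V -> 'rV[R]_d).
Implicit Types (x y z a : V) (F W S N : {set V}) (X : {set {set V}}) (h m : config).

Lemma indep_dot0 F h (n : 'rV[R]_d) : #|F| = d -> indep F h ->
  {in F, forall x, dot n (h x) = 0} -> n = 0.
Proof.
move=> Fd iF n0; have [B [_ BH]] := indep_inv Fd iF.
apply: trmx_inj; rewrite trmx0 -[n^T]mul1mx -BH -mulmxA.
set Hn := _ *m n^T; suff -> : Hn = 0 by rewrite mulmx0.
apply/colP=> i; rewrite !mxE -[RHS](n0 _ (enum_valP i)).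
by apply: eq_bigr => j _; rewrite !mxE mulrC.
Qed.

Lemma mem_adjacent X S x y : S \in X -> x \in S -> y \in S -> adjacent X x y.
Proof. by move=> SX xS yS; apply/existsP; exists S; rewrite SX xS. Qed.

(* Start from a rigid placement h of the contracted family and put v at
   (1 + t) h u. In the limit t = 0, where the edge uv is given the direction h u,
   the common neighbours force m u = m v, so motions descend to the contraction;
   injectivity of the pinned system persists for small t. *)
Lemma generic_rigid_split X X' F N u v : u != v ->
  generic (@rigid_at R d V X') -> u \in cover X' -> v \notin cover X' ->
  cover X \subset v |: cover X' ->
  (forall S', S' \in X' -> exists2 S, S \in X & S' = fold u v S) ->
  F \in X -> #|F| = d -> F \subset cover X' ->
  adjacent X u v -> u \notin N -> v \notin N -> #|N|.+1 = d ->
  {in N, forall a, adjacent X a u && adjacent X a v} ->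
  generic (@rigid_at R d V X).
Proof.
move=> uv gX' uX' vX' XX' foldX FX Fd FX' auv uN vN Nd aN.
suff ex : exists h : config, pinned_rigid X F (directions h).
  apply: generic_imp (generic_and (generic_pinned_rigid ex) (generic_general_position R d V)).
  by move=> h [prh gh]; apply: pinned_rigid_at prh => //; apply: gh.
have [B [[h Bh] _ _] BX'] := generic_and gX' (generic_general_position R d V).
have {B Bh BX'} [rh gh] := BX' h Bh.
pose uvpair x y := (x == u) && (y == v) || (x == v) && (y == u).
pose h0 x := if x == v then h u else h x.
(* [D0 + t D1] is the direction of xy when v sits at [(1 + t) h u], except on uv, where the true
   direction, [t h u] up to sign, is rescaled to [h u] so as not to vanish at t = 0. *)
pose D0 x y := if uvpair x y then h u else h0 x - h0 y.
pose D1 x y := if uvpair x y then 0 else ((x == v)%:R - (y == v)%:R) *: h u.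
have D0E x y : x != v -> y != v -> D0 x y = h x - h y.
  by move=> xv yv; rewrite /D0 /uvpair (negPf xv) (negPf yv) andbF /h0 (negPf xv) (negPf yv).
have D0vE x : x != u -> x != v -> (D0 v x = h u - h x) * (D0 x v = h x - h u).
  move=> xu xv; rewrite /D0 /uvpair (negPf xv) (negPf xu) !andbF /h0 eqxx (negPf xv).
  by rewrite [v == u]eq_sym (negPf uv).
have pr0 : pinned_rigid X F D0.
  move=> m mD mF.
  (* The edge uv makes [m u - m v] orthogonal to [h u]; the edges au and av then make it orthogonal
     to [h a] for each [a] in [N]. These are [d] independent vectors. *)
  have muv : m u = m v.
    apply/eqP; rewrite -subr_eq0; apply/eqP.
    have uNd : #|u |: N| = d by rewrite cardsU1 uN add1n.
    have n_u : dot (m u - m v) (h u) = 0.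
      by have := mD u v auv; rewrite /D0 /uvpair !eqxx.
    apply: indep_dot0 (gh _ uNd) _ => // a; rewrite in_setU1 => /predU1P[->//|aN'].
    have /andP[au av] := aN a aN'.
    have [au' av'] : a != u /\ a != v.
      by split; apply: contraNneq (uN) => E; [rewrite -E|move: vN; rewrite -E aN'].
    have := mD a u au; have := mD a v av; rewrite D0vE // D0E //.
    move: n_u; rewrite !dotBl !dotBr; lra.
  have fm : flex X' h m.
    move=> S' S'X' x y xS' yS'.
    have nv z : z \in S' -> z != v.
      by move=> zS'; apply: contraNneq vX' => <-; apply/bigcupP; exists S'.
    have [S SX S'E] := foldX S' S'X'; move: S'E; rewrite /fold.
    case: ifP => vS S'E; last first.
      rewrite -D0E ?nv //; apply/mD/(mem_adjacent SX); by rewrite -S'E.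
    have inS z : z \in S' -> z != u -> z \in S.
      by rewrite S'E in_setU1 in_setD1 => /predU1P[->|/andP[]//]; rewrite eqxx.
    have [xu|xu] := eqVneq x u; have [yu|yu] := eqVneq y u.
    - by rewrite xu yu subrr dot0l.
    - rewrite xu muv -(D0vE y yu (nv _ yS')).1.
      exact/mD/(mem_adjacent SX vS (inS y yS' yu)).
    - rewrite yu muv -(D0vE x xu (nv _ xS')).2.
      exact/mD/(mem_adjacent SX (inS x xS' xu) vS).
    - rewrite -D0E ?nv //; exact/mD/(mem_adjacent SX (inS x xS' xu) (inS y yS' yu)).
  have [A [b [aA mX']]] := rh m fm.
  have m0 : {in F, forall x, rigid_motion 0 0 h m x}.
    by move=> x xF; rewrite /rigid_motion mF ?xF // mulmx0 addr0.
  have a0 : (0 : 'M[R]_d)^T = - 0 by rewrite trmx0 oppr0.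
  have [A0 b0] := rigid_motion_inj Fd (gh F Fd) aA a0 (sub_in1 (subsetP FX') mX') m0.
  have {}mX' x : x \in cover X' -> m x = 0.
    by move=> /mX'; rewrite /rigid_motion A0 b0 mulmx0 addr0.
  move=> x; have [xX|xX] := boolP (x \in cover X); last by rewrite mF // xX orbT.
  move/subsetP/(_ x xX): XX'; rewrite in_setU1 => /predU1P[->|/mX'//].
  by rewrite -muv mX'.
have [P P0 prP] := pinned_rigid_pencil D1 pr0.
have [t [t0 _ /prP prt]] := small_nonroot P0 ltr01.
exists (fun x => if x == v then (1 + t) *: h u else h x) => m mD mF.
apply: prt => // x y /mD; rewrite /directions /D0 /D1.
have [/orP[]/andP[/eqP-> /eqP->]|nuv] := boolP (uvpair x y).
- rewrite eqxx (negPf uv) scaler0 addr0 !dotBl !dotBr !dotZr => E.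
  have : t * (dot (m u) (h u) - dot (m v) (h u)) = 0 by lra.
  by move/eqP; rewrite mulf_eq0 (gt_eqF t0) => /eqP.
- rewrite eqxx (negPf uv) scaler0 addr0 !dotBl !dotBr !dotZr => E.
  have : t * (dot (m v) (h u) - dot (m u) (h u)) = 0 by lra.
  by move/eqP; rewrite mulf_eq0 (gt_eqF t0) => /eqP.
move=> <-; congr dot; rewrite /h0.
by case: (x == v); case: (y == v); apply/rowP=> i; rewrite !mxE /=; ring.
Qed.

End VertexSplitting.

(** * Minimal cycles *)

Section MinimalCycles.
Variables (R : realType) (n : nat) (V : finType) (k : fieldType).
Notation d := n.+3.
Notation chain := {ffun {set V} -> k}.
Implicit Types (u v x y : V) (S T F W : {set V}) (c e w z : chain).

Lemma generic_rigid_simplex F : #|F| = d -> generic (@rigid_at R d V [set F]).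
Proof.
move=> Fd; apply: generic_imp (generic_general_position R d V) => h gh m fm.
by rewrite cover1; apply: simplex_trivial (gh F Fd) _ => //; apply: fm; rewrite inE.
Qed.

Section Step.
Variables (c : chain) (u v : V) (S0 : {set V}).
Hypotheses (uv : u != v) (mc : minimal (uniform_cycle d) c).
Hypotheses (S0c : S0 \in supp c) (uS0 : u \in S0) (vS0 : v \in S0).
Hypothesis IH : forall c', minimal (uniform_cycle d) c' ->
  (#|cover (supp c')| < #|cover (supp c)|)%N -> generic (@rigid_at R d V (supp c')).

Let P := [set S in supp c | ~~ ((u \in S) && (v \in S))].

(** The pieces of [c] are the minimal vectors of this space. *)
Let L w := supp w \subset P /\ boundary (contract u v w) = 0.

Let closedL : lincomb_closed L.
Proof.
move=> a x y [xP bx] [yP by']; split.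
  apply: subset_trans (suppB _ _) _; rewrite subUset xP /=.
  apply: subset_trans yP; apply/subsetP=> S; rewrite !inE ffunE mulf_eq0.
  by case/norP.
rewrite (raddfB (contract u v)) (raddfB (@boundary V k)) /= bx.
rewrite (contract_scale u v a y) (boundary_scale a) by'.
by apply/ffunP=> S; rewrite !ffunE mulr0 subr0.
Qed.

Let P_supp S : S \in P -> S \in supp c.
Proof. by rewrite inE => /andP[]. Qed.

Let uniform_c : uniform d c.
Proof. by case: mc => -[]. Qed.

Let L_uniform w : L w -> uniform d w.
Proof. by move=> [wP _] S /(subsetP wP)/P_supp/uniform_c. Qed.

Let L_closing w : L w -> uniform_cycle d (closing u v w).
Proof.
move=> Lw; have [_ bw] := Lw; split; first exact: boundary_closing.
exact/uniform_closing/L_uniform.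
Qed.

Let supp_closing w S : L w -> S \in supp (closing u v w) -> ~~ ((u \in S) && (v \in S)) ->
  S \in supp w.
Proof. by move=> Lw; rewrite !inE => zS ?; rewrite -(closing_off uv). Qed.

Let exchange_notin z T x : uniform_cycle d z -> T \in supp z -> x \in T ->
  exists2 y, y \notin T & [/\ y |: (T :\ x) \in supp z, x \notin y |: (T :\ x) &
    forall a, a \in T -> a != x -> a \in y |: (T :\ x)].
Proof.
move=> cz Tz xT; have [y yT yTz] := cycle_exchange cz Tz xT; exists y => //; split=> //.
  by rewrite !inE eqxx orbF; apply: contraNneq yT => <-.
by move=> a aT ax; rewrite !inE aT ax orbT.
Qed.

(** The closing adds only sets containing both u and v, so exchanging one of them out of such a set
    lands in [w] itself. *)
Let circuit_ridge w T x : L w -> T \in supp (closing u v w) -> u \in T -> v \in T ->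
  x \in [set u; v] ->
  exists2 F, F \in supp w & x \notin F /\ (forall a, a \in T -> a != x -> a \in F).
Proof.
move=> Lw Tz uT vT xuv; have xT : x \in T by move: xuv; rewrite !inE => /orP[]/eqP->.
have [y _ [Fz xF aF]] := exchange_notin (L_closing Lw) Tz xT.
exists (y |: (T :\ x)) => //; apply: supp_closing => //.
by move: xuv xF; rewrite in_set2 => /orP[]/eqP-> /negPf->; rewrite ?andbF.
Qed.

(** Otherwise the piece is already a cycle, inside [c] but missing [S0], against the minimality of
    [c]. *)
Let circuit_has_uv e : minimal L e ->
  exists T, [/\ T \in supp (closing u v e), u \in T & v \in T].
Proof.
move=> [Le e0 _]; have [eP _] := Le.
case: (pselect (exists T, [/\ T \in supp (closing u v e), u \in T & v \in T])) => // nT.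
have ze : closing u v e = e.
  apply/ffunP=> S; have [uvS|uvS] := boolP ((u \in S) && (v \in S)); last exact: closing_off.
  have /eqP-> : e S == 0.
    by apply: contraT => eS; have := subsetP eP S; rewrite !inE eS uvS andbF => /(_ isT).
  apply/eqP; apply: contraT => zS; case: nT; exists S; rewrite inE.
  by case/andP: uvS.
have [_ _ /(_ e)] := mc; rewrite -{1}ze => /(_ (L_closing Le) e0).
have ec : supp e \subset supp c by apply/subsetP=> S /(subsetP eP)/P_supp.
move=> /(_ ec) Ec; have := subsetP eP S0.
by rewrite Ec S0c inE uS0 vS0 andbF => /(_ isT).
Qed.

Let fold_notin S : v \notin fold u v S.
Proof.
by rewrite /fold; case: ifP => [_|->//]; rewrite !inE eqxx orbF eq_sym.
Qed.

Let fold_id S : v \notin S -> fold u v S = S.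
Proof. by rewrite /fold => /negPf->. Qed.

Let supp_contract e : supp (contract u v e) \subset fold u v @: supp e.
Proof.
apply/subsetP=> S; rewrite inE contractE //; case: ifP => [|/negbT vS]; first by rewrite eqxx.
have [eS _|] := boolP (S \in supp e).
  by apply/imsetP; exists S; rewrite ?fold_id.
rewrite inE negbK => /eqP->; rewrite add0r; case: ifP => [uS|]; last by rewrite eqxx.
rewrite !mulf_eq0 !negb_or => /and3P[_ _ eS]; apply/imsetP; exists (v |: (S :\ u)).
  by rewrite inE.
by rewrite /fold setU11 setU1K ?setD1K // inE (negPf vS) andbF.
Qed.

(** The reweighted chain is again in [L] and supported in [e], so by minimality of [e] the weight
    vanishes nowhere or everywhere on it. *)
Let circuit_mul e (g : {set V} -> k) : minimal L e ->
  boundary [ffun S => contract u v e S * g S] = 0 ->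
  (exists2 S, S \in supp e & g (fold u v S) != 0) ->
  forall S, S \in supp e -> g (fold u v S) != 0.
Proof.
move=> [[eP be] e0 mine] bg [S1 S1e gS1] S Se.
pose w : chain := [ffun S => e S * g (fold u v S)].
have we : supp w \subset supp e.
  by apply/subsetP=> T; rewrite !inE ffunE mulf_eq0 => /norP[].
have Lw : L w by split; [exact: subset_trans we eP|rewrite contract_mul].
have w0 : w != 0.
  by apply: (@supp_neq0 _ _ _ S1); move: S1e; rewrite !inE ffunE mulf_eq0 negb_or => ->.
by move: Se; rewrite -(mine w Lw w0 we) inE ffunE mulf_eq0 => /norP[].
Qed.

Let generic_rigid_contracted e : minimal L e ->
  generic (@rigid_at R d V (fold u v @: supp e)).
Proof.
move=> me; have [Le e0 _] := me; have [eP be] := Le.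
have [S1 S1e] := supp_ex e0.
have [ce0|ce0] := eqVneq (contract u v e) 0.
  (* When the contraction is zero every weight is allowed. The indicator of one folded simplex shows
     that all simplices of [e] fold to it. *)
  pose g S : k := (S == fold u v S1)%:R.
  have all_S1 S : S \in supp e -> fold u v S = fold u v S1.
    move=> Se; apply/eqP; have : g (fold u v S) != 0.
      apply: circuit_mul me _ _ S Se; last by exists S1; rewrite // /g eqxx oner_eq0.
      rewrite ce0 (_ : [ffun _ => _] = 0) ?raddf0 //.
      by apply/ffunP=> T; rewrite !ffunE mul0r.
    by rewrite /g; case: (_ == fold u v S1) => //; rewrite eqxx.
  have -> : fold u v @: supp e = [set fold u v S1].
    apply/setP=> S; rewrite inE; apply/imsetP/eqP => [[T Te ->]|->]; first exact: all_S1.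
    by exists S1.
  apply: generic_rigid_simplex.
  have := subsetP eP S1 S1e; rewrite inE => /andP[_ uvS].
  rewrite /fold; case: ifP => vS; last by rewrite (L_uniform Le).
  move: uvS; rewrite vS andbT => uS.
  by rewrite cardsU1 !inE (negPf uS) andbF /= -(L_uniform Le S1e) (cardsD1 v S1) vS.
(* A cycle [y] inside the contraction comes from the weight [y / contract u v e], which must then be
   nonzero on all of [e]. So the contraction is minimal and no simplex of [fold u v @: supp e] is
   lost by cancellation. *)
have lift (y : chain) : y != 0 -> uniform_cycle d y -> supp y \subset supp (contract u v e) ->
    fold u v @: supp e \subset supp y.
  move=> y0 [by' _] yce.
  pose g S := y S / contract u v e S.
  have gy : [ffun S => contract u v e S * g S] = y.
    apply/ffunP=> S; rewrite ffunE /g mulrC; have [yS|yS] := eqVneq (y S) 0.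
      by rewrite yS !mul0r.
    by rewrite divfK //; have := subsetP yce S; rewrite !inE => ->.
  have g_supp S : g S != 0 -> S \in supp y.
    by rewrite inE /g mulf_eq0 => /norP[].
  have ex : exists2 S, S \in supp e & g (fold u v S) != 0.
    have [S Sy] := supp_ex y0.
    have /imsetP[T Te TS] := subsetP (supp_contract e) S (subsetP yce S Sy).
    exists T => //; rewrite -TS /g mulf_neq0 ?invr_eq0 //.
      by move: Sy; rewrite inE.
    by have := subsetP yce S Sy; rewrite inE.
  apply/subsetP=> _ /imsetP[S Se ->]; apply: g_supp.
  by apply: circuit_mul me _ ex S Se; rewrite gy.
have ue := L_uniform Le.
have cce : uniform_cycle d (contract u v e) by split; [|exact: uniform_contract].
have cE : supp (contract u v e) = fold u v @: supp e.
  by apply/eqP; rewrite eqEsubset supp_contract lift.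
rewrite -cE; apply: IH.
  split=> // y cy y0 yce; apply/eqP; rewrite eqEsubset yce /=.
  by rewrite cE lift.
apply: proper_card; apply/properP; split; last first.
  exists v; first by apply/bigcupP; exists S0.
  by rewrite cE; apply/bigcupP=> -[_ /imsetP[S _ ->]]; apply/negP/fold_notin.
rewrite cE; apply/subsetP=> x /bigcupP[_ /imsetP[S Se ->] xS].
have Sc : S \in supp c by apply/P_supp/(subsetP eP).
move: xS; rewrite /fold; case: ifP => _ xS; last by apply/bigcupP; exists S.
move: xS; rewrite !inE => /predU1P[->|/andP[_ xS]]; last by apply/bigcupP; exists S.
by apply/bigcupP; exists S0.
Qed.

(** The edge uv is added by hand, since no simplex of [e] contains both ends; in [c] it is present
    through [S0]. *)
Let generic_rigid_circuit e : minimal L e ->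
  generic (@rigid_at R d V ([set u; v] |: supp e)).
Proof.
move=> me; have [T [Tz uT vT]] := circuit_has_uv me.
have [Le _ _] := me; set X := _ |: _; set z := closing u v e in Tz.
have cz : uniform_cycle d z by exact: L_closing.
have eX S : S \in supp e -> S \in X by move=> Se; rewrite in_setU1 Se orbT.
have adj T' a : T' \in supp z -> u \in T' -> v \in T' -> a \in T' -> a != u -> a != v ->
    adjacent X a u && adjacent X a v.
  move=> T'z uT' vT' aT' au av.
  have [F Fe [_ aF]] := circuit_ridge Le T'z uT' vT' (set22 u v).
  have [F' F'e [_ aF']] := circuit_ridge Le T'z uT' vT' (set21 u v).
  rewrite (mem_adjacent (eX F Fe)) ?aF //.
  by rewrite (mem_adjacent (eX F' F'e)) ?aF' // eq_sym.
have cardT : #|T| = d by case: cz => _; apply.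
have cardTuv : #|T :\ u :\ v| = n.+1.
  move: cardT; rewrite (cardsD1 u) uT (cardsD1 v) !inE vT eq_sym uv /=.
  by case.
(* The d - 2 vertices of [T] other than u and v are common neighbours. Exchanging one of them, [y],
   in the closing keeps u and v and provides the missing neighbour [x]. *)
have [y yT] : exists y, y \in T :\ u :\ v by apply/set0Pn; rewrite -card_gt0 cardTuv.
have [yv [yu yT']] : y != v /\ y != u /\ y \in T by move: yT; rewrite !inE => /and3P[].
have [x xT [T2z yT2 aT2]] := exchange_notin cz Tz yT'.
have [xu xv] : x != u /\ x != v by split; apply: contraNneq xT => ->.
have [F Fe [vF aF]] := circuit_ridge Le Tz uT vT (set22 u v).
have FX' : F \in fold u v @: supp e by apply/imsetP; exists F; rewrite ?fold_id.
apply: (@generic_rigid_split R d V X (fold u v @: supp e) F (x |: (T :\ u :\ v)) u v) => //.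
- exact: generic_rigid_contracted.
- by apply/bigcupP; exists F; rewrite ?aF.
- by apply/bigcupP => -[_ /imsetP[S _ ->]]; apply/negP/fold_notin.
- have uX' : u \in cover (fold u v @: supp e) by apply/bigcupP; exists F; rewrite ?aF.
  apply/subsetP=> a /bigcupP[S]; rewrite [S \in X]in_setU1 => /predU1P[->|Se] aS.
    by move: aS; rewrite !inE => /orP[]/eqP->; rewrite ?eqxx // uX' orbT.
  rewrite in_setU1; have [//|av] := eqVneq a v; apply/bigcupP; exists (fold u v S).
    exact: imset_f.
  by rewrite /fold; case: ifP => // _; rewrite !inE av aS orbT.
- by move=> _ /imsetP[S Se ->]; exists S => //; exact: eX.
- exact: eX.
- exact: L_uniform Fe.
- by apply/subsetP=> a aF'; apply/bigcupP; exists F.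
- by apply: (@mem_adjacent _ _ [set u; v]); rewrite ?set21 ?set22 // setU11.
- by rewrite !inE eqxx [u == x]eq_sym (negPf xu) andbF.
- by rewrite !inE eqxx [v == x]eq_sym (negPf xv).
- by rewrite cardsU1 !inE (negPf xT) !andbF cardTuv.
move=> a; rewrite in_setU1 => /predU1P[->|].
  by apply: (adj _ _ T2z (aT2 u uT _) (aT2 v vT _) (setU11 _ _)) => //; rewrite eq_sym.
by rewrite !inE => /and3P[av au aT]; apply: (adj T).
Qed.

Let supp_c_in S : S \in supp c -> v \notin S -> S \in P.
Proof. by rewrite inE => ? /negPf vS; rewrite !inE vS andbF andbT. Qed.

Let cP : chain := [ffun S => if S \in P then c S else 0].

Let L_cP : L cP.
Proof.
split.
  by apply/subsetP=> S; rewrite inE ffunE; case: ifP => //; rewrite eqxx.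
(* Simplices containing both u and v contribute nothing to the contraction. *)
have -> : contract u v cP = contract u v c.
  apply/ffunP=> S; rewrite !contractE // !ffunE; case: ifP => // /negbT vS.
  have cPE T : ~~ ((u \in T) && (v \in T)) -> (if T \in P then c T else 0) = c T.
    move=> uvT; rewrite !inE uvT andbT.
    by case: eqVneq.
  rewrite !cPE //; first by rewrite !inE eqxx (negPf uv).
  by rewrite (negPf vS) andbF.
have [[bc _] _ _] := mc.
by rewrite boundary_contract // bc raddf0.
Qed.

Lemma generic_rigid_step : generic (@rigid_at R d V (supp c)).
Proof.
have [cc c0 minc] := mc.
(* Indexing by the support [X], not by [e], keeps the intersection of generic conditions finite. *)
have gX (X : {set {set V}}) : generic (fun h =>
    (exists2 e, minimal L e & supp e = X) -> @rigid_at R d V ([set u; v] |: X) h).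
  have [[e me <-]|ne] := pselect (exists2 e, minimal L e & supp e = X).
    by apply: generic_imp (generic_rigid_circuit me).
  exact: generic_true.
apply: generic_imp (generic_and (generic_general_position R d V) (generic_forall gX)).
move=> h [gh {gX}rh] m fm.
have trivX e : minimal L e -> trivial (cover ([set u; v] |: supp e)) h m.
  move=> me; apply: rh; first by exists e.
  have [[eP _] _ _] := me.
  move=> S; rewrite in_setU1 => /predU1P[->|/(subsetP eP)/P_supp]; last exact: fm.
  have sub : {subset [set u; v] <= S0} by move=> x; rewrite !inE => /orP[]/eqP->.
  by move=> x y /sub xS /sub yS; apply: (fm S0).
have covX e S : S \in supp e -> S \subset cover ([set u; v] |: supp e).
  by move=> Se; apply: bigcup_max (subxx S); rewrite in_setU1 Se orbT.
have vX e : v \in cover ([set u; v] |: supp e).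
  by apply/bigcupP; exists [set u; v]; rewrite ?setU11 ?set22.
have [x0 _ [p0c vp0 _]] := exchange_notin cc S0c vS0; set p0 := x0 |: _ in p0c vp0.
have p0P := supp_c_in p0c vp0.
have P_cP S : S \in P -> S \in supp cP.
  by move=> SP; have := P_supp SP; rewrite !inE ffunE SP.
have [e0 [me0 _ p0e0]] := minimal_through closedL L_cP (P_cP p0 p0P).
have [A [b [aA mW0]]] := trivX e0 me0.
pose W := [set x | m x == h x *m A + b].
have W0 : cover ([set u; v] |: supp e0) \subset W.
  by apply/subsetP=> x /mW0 mx; rewrite inE; apply/eqP.
have ext e F : minimal L e -> F \subset W -> #|F| = d ->
    F \subset cover ([set u; v] |: supp e) -> cover ([set u; v] |: supp e) \subset W.
  move=> me FW Fd Fe; have mF : {in F, forall x, rigid_motion A b h m x}.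
    by move=> x /(subsetP FW); rewrite inE => /eqP.
  apply/subsetP=> x xe; rewrite inE; apply/eqP.
  exact: rigid_motion_extend Fd (gh F Fd) aA mF Fe (trivX e me) x xe.
(* By [ext], a piece with one simplex in [W] has all its simplices there, so [Q] is a union of
   pieces and [cP] restricts to it within [L]. *)
pose Q := [set S in P | S \subset W].
have vW : v \in W by apply: (subsetP W0).
suff PQ : P \subset Q.
  exists A, b; split=> // x /bigcupP[S Sc xS].
  suff: x \in W by rewrite inE => /eqP.
  have QW T : T \in P -> T \subset W by move/(subsetP PQ); rewrite inE => /andP[].
  have [SP|SP] := boolP (S \in P); first exact: (subsetP (QW S SP)).
  have vS : v \in S.
    by apply: contraNT SP => vS; apply: supp_c_in.
  have [y _ [Tc vT aT]] := exchange_notin cc Sc vS.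
  have [->//|xv] := eqVneq x v.
  by apply: (subsetP (QW _ (supp_c_in Tc vT))); apply: aT.
apply/subsetP=> p1 p1P; apply: contraT => p1Q.
pose w : chain := [ffun S => if S \in Q then cP S else 0].
have Lw : L w.
  apply: (restrict_to_minimal_union closedL) => // e S S' me eP Se S'e.
  rewrite [in S \in Q]inE => /andP[SP SW].
  have Lcp := L_cP.1.
  rewrite inE (subsetP Lcp) ?(subsetP eP) //=.
  apply: subset_trans (covX e S' S'e) _; apply: ext SW _ _ => //.
    exact/uniform_c/P_supp.
  exact: covX.
have cz := L_closing Lw; set z := closing u v w in cz.
have wQ S : S \in supp w -> S \in Q.
  by rewrite inE ffunE; case: ifP => //; rewrite eqxx.
have zoff S : v \notin S -> z S = w S.
  by move=> vS; apply: closing_off => //; rewrite (negPf vS) andbF.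
have p0Q : p0 \in Q.
  by rewrite inE p0P; apply: subset_trans (covX _ _ p0e0) W0.
have z0 : z != 0.
  apply: (@supp_neq0 _ _ _ p0); rewrite inE zoff // 2!ffunE p0Q p0P.
  by move: p0c; rewrite inE.
have zuv S : S \in supp z -> S \notin supp c -> (u \in S) && (v \in S).
  move=> Sz; apply: contraNT => /(supp_closing Lw Sz)/wQ.
  by rewrite inE => /andP[/P_supp].
(* The cycle [z] misses [p1], so by minimality of [c] it cannot lie inside [c]; it uses a new set
   [T], which contains uv. *)
have [T Tz Tc] : exists2 T, T \in supp z & T \notin supp c.
  apply/subsetPn; apply/negP => zc.
  have := P_supp p1P; rewrite -(minc z cz z0 zc) inE /z closing_off //; last first.
    by move: p1P; rewrite inE => /andP[].
  by rewrite ffunE (negPf p1Q) eqxx.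
have /andP[uT vT] := zuv T Tz Tc.
have Td : #|T| = d by case: cz => _; apply.
have TW : T \subset W.
  have [y _ [Fz vF aF]] := exchange_notin cz Tz vT.
  have : y |: (T :\ v) \in supp w by rewrite inE -zoff //; move: Fz; rewrite inE.
  move/wQ; rewrite inE => /andP[_ /subsetP FW].
  apply/subsetP=> a aT; have [->//|av] := eqVneq a v; exact/FW/aF.
(* [T] also lies in [c - z]. Exchanging v out of it gives [p'] where [c] and [w] differ, hence [p']
   in [P] but not in [Q]. The piece through [p'] covers [T], whose [d] vertices are in [W], so it is
   glued to [W] after all. *)
pose z' : chain := c - [ffun S => 1 * z S].
have cz' : uniform_cycle d z' by exact: cycle_lincomb.
have z'E S : z' S = c S - z S.
  by rewrite /z'; move: (z) => z1; rewrite !ffunE mul1r.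
have Tz' : T \in supp z'.
  by move: Tz Tc; rewrite !inE negbK z'E => Tz /eqP->; rewrite sub0r oppr_eq0.
have [y _ [Fz' vF aF]] := exchange_notin cz' Tz' vT.
set p' := y |: _ in Fz' vF aF.
have cwp' : c p' != w p'.
  by move: Fz'; rewrite inE z'E zoff // subr_eq0.
have p'c : p' \in supp c.
  rewrite inE; apply: contraNneq cwp' => cp'; rewrite cp' !ffunE cp'.
  by rewrite !if_same.
have p'P := supp_c_in p'c vF.
have p'Q : p' \notin Q.
  by apply: contraNN cwp' => p'Q; rewrite !ffunE p'Q p'P.
have [e' [me' _ p'e']] := minimal_through closedL L_cP (P_cP p' p'P).
case/negP: p'Q; rewrite inE p'P /=.
apply: subset_trans (covX e' p' p'e') _; apply: ext TW _ _ => //.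
apply/subsetP=> a aT; have [->|av] := eqVneq a v; first exact: vX.
by apply: (subsetP (covX e' p' p'e')); apply: aF.
Qed.

End Step.

Theorem generic_rigid_minimal_cycle c : minimal (uniform_cycle d) c ->
  generic (@rigid_at R d V (supp c)).
Proof.
have [N] := ubnP #|cover (supp c)|; elim: N c => // N IHN c /ltnSE le_N mc.
have [[_ uc] c0 _] := mc.
have [S Sc] := supp_ex c0.
have /card_gt1P[u [v [uS vS uv]]] : (1 < #|S|)%N by rewrite (uc S Sc).
apply: (generic_rigid_step uv mc Sc uS vS) => c' mc' lt_c'.
by apply: IHN => //; apply: leq_trans lt_c' le_N.
Qed.
End MinimalCycles.

(** * Doubly Cohen-Macaulay complexes *)

Section TwoCM.
Variables (V : finType) (k : fieldType) (n : nat) (K : {set {set V}}).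
Notation chain := {ffun {set V} -> k}.
Implicit Types (u v x y : V) (S T F G : {set V}) (L : {set {set V}}) (c e z : chain).

Lemma face_dim_card S (i : nat) : #|S| = i.+1 -> face_dim S = i.
Proof. by move=> Si; rewrite /face_dim Si -addn1 PoszD addrK. Qed.

Lemma card_face_dim S (i : nat) : face_dim S = i -> #|S| = i.+1.
Proof. by move/eqP; rewrite subr_eq -PoszD addn1 => /eqP[]. Qed.

Lemma face_dim_le L S : S \in L -> face_dim S <= cplx_dim L.
Proof. by move=> SL; rewrite lerD2r lez_nat (leq_bigmax_cond _ SL). Qed.

Lemma pure_facet L d S : pure L -> cplx_dim L = d%:Z - 1 -> S \in L ->
  exists F, [/\ F \in L, S \subset F & #|F| = d].
Proof.
move=> pL dL SL; have [F mF SF] := maxset_exists (P := fun T => T \in L) SL.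
exists F; split=> //; first exact: maxsetp mF.
by have := pL F mF; rewrite dL => /addIr[].
Qed.

Lemma setD_in_link L F T : F \in L -> T \subset F -> F :\: T \in L ->
  F :\: T \in link L T.
Proof.
move=> FL TF DL; rewrite inE DL -{3}(setIidPr TF) setID FL andbT.
by apply/eqP/setP=> x; rewrite !inE; case: (x \in T).
Qed.

Lemma boundary_set0 c : boundary c set0 = \sum_v c [set v].
Proof.
rewrite ffunE; apply: eq_big => [v|v _]; first by rewrite inE.
rewrite (_ : [set u in set0 | _] = set0) ?cards0 ?expr0 ?mul1r ?setU0 //.
by apply/setP=> u; rewrite !inE.
Qed.

Definition point_difference x y : chain :=
  [ffun S => (S == [set x])%:R - (S == [set y])%:R].

Lemma point_difference_cycle x y : uniform_cycle 1 (point_difference x y).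
Proof.
split; last first.
  move=> S; rewrite inE ffunE; have [->|Sx] := eqVneq S [set x]; first by rewrite cards1.
  by have [->|Sy] := eqVneq S [set y]; rewrite ?cards1 // subr0 eqxx.
apply/ffunP=> S; have [->|S0] := eqVneq S set0.
  rewrite boundary_set0 ffunE; under eq_bigr do rewrite ffunE.
  rewrite sumrB (bigD1 x) //= eqxx big1 => [|u /negPf ux]; last by rewrite (inj_eq set1_inj) ux.
  rewrite (bigD1 y) //= eqxx big1 => [|u /negPf uy]; last by rewrite (inj_eq set1_inj) uy.
  by rewrite subrr.
rewrite !ffunE big1 // => v vS; rewrite ffunE.
have neq w : (v |: S == [set w]) = false.
  apply: contraNF S0 => /eqP vSz; rewrite -cards_eq0 -eqSS.
  by have := cardsU1 v S; rewrite vS vSz cards1 add1n => <-.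
by rewrite !neq subrr mulr0.
Qed.

Lemma point_difference_supp x y : x != y ->
  supp (point_difference x y) = [set [set x]; [set y]].
Proof.
move=> xy; apply/setP=> S; rewrite !inE ffunE.
have [->|Sx] := eqVneq S [set x].
  by rewrite (inj_eq set1_inj) (negPf xy) subr0 oner_eq0.
by have [_|_] := eqVneq S [set y]; rewrite ?sub0r ?subr0 ?oppr_eq0 ?oner_eq0 ?eqxx.
Qed.

(** The base of the descent: for the augmented boundary a single point is not a cycle, and exchange
    at one point produces the other. *)
Lemma point_difference_minimal x y : x != y ->
  minimal (uniform_cycle 1) (point_difference x y).
Proof.
move=> xy; have sE := point_difference_supp xy; split.
- exact: point_difference_cycle.
- by apply: (@supp_neq0 _ _ _ [set x]); rewrite sE set21.
move=> z cz /supp_ex[S Sz] zs; apply/eqP; rewrite eqEsubset zs /= sE.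
have other a b : [set a] \in supp z -> supp z \subset [set [set a]; [set b]] ->
    [set b] \in supp z.
  move=> az /subsetP zab; have [w wa] := cycle_exchange cz az (set11 a).
  rewrite setDv setU0 => wz; have := zab _ wz; rewrite !inE !(inj_eq set1_inj).
  case/orP=> /eqP E; first by rewrite E inE eqxx in wa.
  by rewrite -E; move: wz; rewrite inE.
have := subsetP zs S Sz; rewrite sE !inE subUset !sub1set => /orP[]/eqP SE.
  by move: Sz; rewrite SE => xz; rewrite xz (other x) // -sE.
by move: Sz; rewrite SE => yz; rewrite yz (other y) // setUC -sE.
Qed.

Notation d := n.+1.
Hypotheses (cK : simplicial_complex K) (dK : cplx_dim K = d%:Z - 1).
Hypothesis cmK : two_CM k K.

Let K_sub S T : S \in K -> T \subset S -> T \in K.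
Proof. by case: cK => _; apply. Qed.

Lemma two_CM_facet S : S \in K -> exists F, [/\ F \in K, S \subset F & #|F| = d].
Proof. by apply: pure_facet dK => //; case: cmK => -[]. Qed.

(* Descending along the common ridge of F and F', a minimal cycle in the link
   of v |: T is coned from v and capped off inside K - v. Any minimal cycle in
   the result through F has, at v, the whole original cycle as its link, so it
   contains F' too. *)
Lemma common_minimal_cycle_link F F' j T : F \in K -> F' \in K ->
  #|F| = d -> #|F'| = d -> #|F :&: F'| = n -> T \subset F :&: F' ->
  #|(F :&: F') :\: T| = j ->
  exists c, [/\ minimal (uniform_cycle j.+1) c, supp c \subset link K T,
    F :\: T \in supp c & F' :\: T \in supp c].
Proof.
move=> FK F'K Fd F'd Rn; elim: j T => [|j IHj] T TR.
  move=> /eqP; rewrite cards_eq0 setD_eq0 => RT.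
  have {TR RT} -> : T = F :&: F' by apply/eqP; rewrite eqEsubset TR.
  have /cards1P[p pE] : #|F :\: (F :&: F')| == 1%N.
    by rewrite cardsDS ?subsetIl // Fd Rn subSnn.
  have /cards1P[q qE] : #|F' :\: (F :&: F')| == 1%N.
    by rewrite cardsDS ?subsetIr // F'd Rn subSnn.
  have pq : p != q.
    apply: contra_eq_neq pE => ->; rewrite -qE; apply/eqP=> E.
    have : q \in F :\: (F :&: F') by rewrite E qE set11.
    have : q \in F' :\: (F :&: F') by rewrite qE set11.
    by rewrite !inE => /andP[/nandP[/negPf->|/negPf->]].
  rewrite pE qE; exists (point_difference p q).
  rewrite point_difference_supp // set21 set22; split=> //.
    exact: point_difference_minimal.
  apply/subsetP=> S; rewrite in_set2 => /orP[]/eqP->; rewrite -?pE -?qE.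
    by apply: setD_in_link (K_sub FK _); rewrite ?subsetIl ?subsetDl.
  by apply: setD_in_link (K_sub F'K _); rewrite ?subsetIr ?subsetDl.
move=> card_RT.
have [v] : exists v, v \in (F :&: F') :\: T by apply/set0Pn; rewrite -card_gt0 card_RT.
rewrite inE => /andP[vT vR]; have [vF vF'] := setIP vR.
have T1R : v |: T \subset F :&: F' by rewrite subUset sub1set vR.
have card_RT1 : #|(F :&: F') :\: (v |: T)| = j.
  by move: card_RT; rewrite (cardsD1 v) in_setD vT vR add1n setDDl setUC => -[].
have [c [mc cL Fc F'c]] := IHj _ T1R card_RT1.
have FT1 (H : {set V}) : v \in H -> (H :\: T) :\ v = H :\: (v |: T) by rewrite setDDl setUC.
have [[bc uc] c0 minc] := mc.
have vK : [set v] \in K by apply: K_sub FK _; rewrite sub1set.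
have [_ /(_ v vK)[[pKv cmKv] dKv]] := cmK.
have TK : T \in K by apply: K_sub FK (subset_trans TR (subsetIl _ _)).
have TKv : T \in deletion K v by rewrite inE TK.
(* The facet [G] of K - v serves to bound the dimension of the link of [T] there from below, which
   puts degree j in the vanishing range. *)
have [G [GKv TG Gd]] := pure_facet pKv (etrans dKv dK) TKv.
have GL : G :\: T \in link (deletion K v) T.
  apply: setD_in_link => //; move: GKv; rewrite !inE => /andP[GK vG].
  by rewrite (K_sub GK) ?subsetDl // negb_and vG orbT.
have cardGT : #|G :\: T| = j.+2.
  move: card_RT; rewrite !cardsD (setIidPr TR) (setIidPr TG) Gd Rn.
  by move=> E; rewrite subSn ?E // -Rn subset_leq_card.
have [b bL bE] : is_boundary (link (deletion K v) T) j%:Z c.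
  apply: cmKv => //.
    by apply: lt_le_trans (face_dim_le GL); rewrite (face_dim_card cardGT) ltz_nat.
  split=> // S cS; have Sc : S \in supp c by rewrite inE.
  split; last exact/face_dim_card/uc.
  move: (subsetP cL S Sc); rewrite !inE => /and3P[SK /eqP TS TSK].
  have vS : v \notin S.
    by apply/negP=> vS; have := in_set0 v; rewrite -TS inE setU11 vS.
  rewrite SK vS negb_or vT vS (K_sub TSK) ?setSU ?subsetUr //= andbT.
  by rewrite -subset0 -TS setSI ?subsetUr.
have bS S : b S != 0 -> [/\ S \in link K T, v \notin S & #|S| = j.+2].
  move=> /bL[]; rewrite !inE => /and3P[/andP[-> ->] -> /andP[-> _]].
  by rewrite -PoszD addn1 => /card_face_dim.
have bv S : v \in S -> b S = 0.
  by move=> vS; apply/eqP; apply: contraLR vS => /bS[].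
(* The cone over [c] from v and the cap [b] avoiding v both have boundary [c]. *)
pose z := jn v c - b.
have zv S : v \in S -> z S = sgn k v S * c (S :\ v).
  by move=> vS; rewrite !ffunE vS bv // subr0.
have cz : uniform_cycle j.+2 z.
  split; first by rewrite raddfB /= boundary_jn bc raddf0 subr0 bE subrr.
  apply: uniformB; first exact: uniform_jn.
  by move=> S; rewrite inE => /bS[].
have FTz : F :\: T \in supp z.
  rewrite inE zv ?inE ?vT // FT1 // mulf_neq0 ?sgn_neq0 //.
  by move: Fc; rewrite inE.
have [e [me ez FTe]] := minimal_through (@cycle_lincomb _ _ _) cz FTz.
have [[be ue] _ _] := me.
have lke (H : {set V}) : v \in H -> (H :\: (v |: T) \in supp (lk v e)) = (H :\: T \in supp e).
  move=> vH; rewrite !inE ffunE !inE eqxx /= mulf_eq0 (negPf (sgn_neq0 _ _ _)) /=.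
  by rewrite -FT1 // setD1K // inE vT.
have le : supp (lk v e) = supp c.
  apply: minc.
  - split; first by rewrite boundary_lk be raddf0 oppr0.
    exact: uniform_lk.
  - by apply: (@supp_neq0 _ _ _ (F :\: (v |: T))); rewrite lke.
  apply/subsetP=> S; rewrite inE ffunE; case: ifP => [|/negbT vS]; first by rewrite eqxx.
  rewrite mulf_eq0 negb_or => /andP[_ eS].
  have := subsetP ez (v |: S); rewrite !inE zv ?setU11 // setU1K // mulf_eq0 negb_or.
  by move=> /(_ eS)/andP[].
exists e; split=> //; last by rewrite -lke // le.
apply: subset_trans ez _; apply/subsetP=> S Sz.
have [vS|vS] := boolP (v \in S); last first.
  have /bS[//] : b S != 0.
  by move: Sz; rewrite inE !ffunE (negPf vS) sub0r oppr_eq0.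
have Sc : S :\ v \in supp c.
  by move: Sz; rewrite !inE zv // mulf_eq0 negb_or => /andP[].
have := subsetP cL _ Sc; rewrite !inE => /and3P[_ /eqP TS TSK].
have TSK' : T :|: S \in K by rewrite -(setD1K vS) setUCA setUA.
rewrite TSK' (K_sub TSK') ?subsetUr // andbT -subset0; apply/subsetP=> a.
rewrite inE => /andP[aT aS]; have : a \in (v |: T) :&: (S :\ v).
  by rewrite !inE aT aS orbT andbT; apply: contraNneq vT => <-.
by rewrite TS inE.
Qed.

Lemma common_minimal_cycle F F' : F \in K -> F' \in K ->
  #|F| = d -> #|F'| = d -> #|F :&: F'| = n ->
  exists c, [/\ minimal (uniform_cycle d) c, supp c \subset K, F \in supp c & F' \in supp c].
Proof.
move=> FK F'K Fd F'd Rn.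
have := common_minimal_cycle_link FK F'K Fd F'd Rn (sub0set _) (erefl _).
rewrite !setD0 Rn => -[c [mc cL Fc F'c]]; exists c; split=> //.
by apply: subset_trans cL _; apply/subsetP=> S; rewrite inE => /andP[].
Qed.

(* The 0-cycle x - y bounds b in the link of T; the part of b on the vertices
   already reached has boundary x alone unless y is reached too, and a
   0-boundary has coefficient sum 0. *)
Lemma facets_connected (Q : pred {set V}) :
  (forall F F', F \in K -> F' \in K -> #|F| = d -> #|F'| = d ->
     #|F :&: F'| = n -> Q F -> Q F') ->
  forall F F', F \in K -> F' \in K -> #|F| = d -> #|F'| = d -> Q F -> Q F'.
Proof.
move=> Qadj F0 F0' F0K F0'K F0d F0'd.
(* Induction on the codimension of [T]. Facets sharing a further vertex are linked by induction, so
   only the vertices of the link of [T] remain to be connected. *)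
suff conn j T : T \in K -> (#|T| + j)%N = d -> forall F F', F \in K -> F' \in K ->
    #|F| = d -> #|F'| = d -> T \subset F -> T \subset F' -> Q F -> Q F'.
  by apply: (conn d set0); rewrite ?sub0set ?cards0 //; case: cK.
elim: j T => [|[_|j IHj]] T TK Td F F' FK F'K Fd F'd TF TF'.
- have TE (H : {set V}) : #|H| = d -> T \subset H -> T = H.
    by move=> Hd TH; apply/eqP; rewrite eqEcard TH Hd -Td addn0 leqnn.
  by rewrite -(TE F' F'd TF') (TE F Fd TF).
- have [->//|FF'] := eqVneq F F'; apply: Qadj => //.
  have TI : T \subset F :&: F' by rewrite subsetI TF.
  have := subset_leq_card TI; rewrite -ltnS -addn1 Td => leI.
  have : F :&: F' \proper F.
    rewrite properE subsetIl subsetI subxx /=; apply: contra FF' => FF'.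
    by rewrite eqEcard FF' Fd F'd leqnn.
  by move/proper_card; rewrite Fd => ltI; apply/eqP; rewrite eqn_leq -ltnS ltI -ltnS.
have pick (H : {set V}) : #|H| = d -> T \subset H -> exists2 x, x \in H & x \notin T.
  move=> Hd TH; apply/subsetPn; apply: contraL (leqnn d) => HT.
  by rewrite -ltnNge -{1}Hd -Td (leq_ltn_trans (subset_leq_card HT)) // -addSnnS leq_addr.
have [x xF xT] := pick F Fd TF; have [y yF' yT] := pick F' F'd TF'.
have sub_facet w (H : {set V}) : w \in H -> T \subset H -> w |: T \subset H.
  by move=> wH TH; rewrite subUset sub1set wH.
have IH w : w \notin T -> w |: T \in K -> forall F F', F \in K -> F' \in K ->
    #|F| = d -> #|F'| = d -> w |: T \subset F -> w |: T \subset F' -> Q F -> Q F'.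
  by move=> wT wK; apply: IHj; rewrite // cardsU1 wT -Td add1n addSnnS.
move=> QF; have [xy|xy] := eqVneq x y.
  apply: (IH x xT _ F F' FK F'K Fd F'd) => //; rewrite ?sub_facet // ?xy //.
  by apply: K_sub F'K _; rewrite sub_facet.
pose C := [set w | [&& w \notin T, w |: T \in K &
  [forall G in K, (#|G| == d) ==> (w |: T \subset G) ==> Q G]]].
have CP w : w \in C -> forall G, G \in K -> #|G| = d -> w |: T \subset G -> Q G.
  rewrite inE => /and3P[_ _ /forallP QC] G GK Gd wG.
  by have := QC G; rewrite GK Gd eqxx wG.
have CI w G : w \notin T -> G \in K -> #|G| = d -> w |: T \subset G -> Q G -> w \in C.
  move=> wT GK Gd wG QG; have wK := K_sub GK wG; rewrite inE wT wK /=.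
  apply/forallP=> H; apply/implyP=> HK; apply/implyP=> /eqP Hd; apply/implyP=> wH.
  exact: (IH w wT wK G H GK HK Gd Hd wG wH QG).
have xC : x \in C by apply: CI QF => //; apply: sub_facet.
suff yC : y \in C by apply: (CP y) => //; apply: sub_facet.
have linkT w (H : {set V}) : w \in H -> w \notin T -> T \subset H -> H \in K -> [set w] \in link K T.
  move=> wH wT TH HK; rewrite inE; apply/and3P; split.
  - by apply: K_sub HK _; rewrite sub1set.
  - by rewrite setI_eq0 disjoint_sym disjoints1.
  - by apply: K_sub HK _; rewrite subUset TH sub1set.
have [b bL bE] : is_boundary (link K T) 0 (point_difference x y).
  have [[_ cm] _] := cmK; apply: (cm T TK).
    have FL : F :\: T \in link K T.
      by apply: setD_in_link (K_sub FK _); rewrite ?subsetDl.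
    apply: lt_le_trans (face_dim_le FL); rewrite (@face_dim_card _ j.+1) ?ltz_nat //.
    by rewrite cardsD (setIidPr TF) Fd -Td addKn.
  split; last by case: (point_difference_cycle x y).
  move=> S pS; have : S \in supp (point_difference x y) by rewrite inE.
  rewrite point_difference_supp // in_set2 => /orP[]/eqP->.
    by split; [exact: linkT xF xT TF FK|apply: face_dim_card; rewrite cards1].
  by split; [exact: linkT yF' yT TF' F'K|apply: face_dim_card; rewrite cards1].
pose bC : chain := [ffun S : {set V} => if S \subset C then b S else 0].
have bCE w : boundary bC [set w] = if w \in C then point_difference x y [set w] else 0.
  rewrite -bE !ffunE; case: ifP => wC; last first.
    by apply: big1 => v _; rewrite ffunE subUset sub1set [in X in _ && X]sub1set wC andbF mulr0.
  apply: eq_bigr => v; rewrite inE => vw; rewrite ffunE subUset !sub1set wC andbT.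
  (* An edge vw of [b] lies with [T] in a facet; if w is in [C] then [Q] holds for it, so v is in
     [C]. Thus no edge of [b] leaves [C]. *)
  have [//|/negPf vC] := ifPn; have [->//|bvw] := eqVneq (b (v |: [set w])) 0.
  have [] := bL _ bvw; rewrite inE => /and3P[_ /eqP TI TK'] _.
  have [G [GK sG Gd]] := two_CM_facet TK'.
  have [vG wG TG] : [/\ v \in G, w \in G & T \subset G].
    by split; [apply: (subsetP sG); rewrite !inE eqxx orbT|
      apply: (subsetP sG); rewrite !inE eqxx !orbT|
      apply: subset_trans sG; apply: subsetUl].
  have vT : v \notin T.
    by apply/negP=> vT; have := in_set0 v; rewrite -TI !inE vT eqxx.
  by rewrite (CI v G) ?sub_facet // ?(CP w) ?sub_facet // in vC.
have := congr1 (fun c => c set0) (boundary_boundary bC).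
rewrite boundary_set0 ffunE; under eq_bigr do rewrite bCE.
apply: contra_eqT => yC; rewrite (bigD1 x) //= xC big1 => [|w wx].
  by rewrite addr0 ffunE eqxx (inj_eq set1_inj) (negPf xy) subr0 oner_eq0.
have [wy|wy] := eqVneq w y; first by rewrite wy (negPf yC).
by rewrite ffunE !(inj_eq set1_inj) (negPf wx) (negPf wy) subrr if_same.
Qed.

End TwoCM.

Lemma generic_rigid_two_CM (R : realType) n (V : finType) (k : fieldType)
    (K : {set {set V}}) :
  simplicial_complex K -> cplx_dim K = n.+3%:Z - 1 -> two_CM k K ->
  generic (@rigid_at R n.+3 V K).
Proof.
move=> cK dK cmK.
have gX (X : {set {set V}}) : generic (fun h =>
    (exists2 c : {ffun {set V} -> k}, minimal (uniform_cycle n.+3) c & supp c = X) ->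
    @rigid_at R n.+3 V X h).
  have [[c mc <-]|nc] :=
    pselect (exists2 c : {ffun {set V} -> k}, minimal (uniform_cycle n.+3) c & supp c = X).
    by apply: generic_imp (generic_rigid_minimal_cycle R mc).
  exact: generic_true.
apply: generic_imp (generic_and (generic_general_position R n.+3 V) (generic_forall gX)).
move=> h [gh {gX}rh] m fm.
have [F0 [F0K _ F0d]] := two_CM_facet dK cmK cK.1.
have [A [b [aA mF0]]] := simplex_trivial F0d (gh F0 F0d) (fm F0 F0K).
pose W := [set x | m x == h x *m A + b].
have QF0 : F0 \subset W by apply/subsetP=> x /mF0 mx; rewrite inE; apply/eqP.
exists A, b; split=> // x /bigcupP[S SK xS].
have [F [FK SF Fd]] := two_CM_facet dK cmK SK.
suff: F \subset W by move=> /subsetP/(_ x (subsetP SF x xS)); rewrite inE => /eqP.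
apply: (facets_connected cK dK cmK (Q := fun F => F \subset W)) QF0 => //.
move=> {x xS S SK F FK SF Fd} F F' FK F'K Fd F'd FF'd FW.
have [c [mc cK' Fc F'c]] := common_minimal_cycle cK dK cmK FK F'K Fd F'd FF'd.
have sub_cover G : G \in supp c -> G \subset cover (supp c).
  by move=> Gc; apply: bigcup_max (subxx G).
have triv : trivial (cover (supp c)) h m.
  by apply: rh; [exists c|move=> S /(subsetP cK'); apply: fm].
have mF : {in F, forall x, rigid_motion A b h m x}.
  by move=> x /(subsetP FW); rewrite inE => /eqP.
apply/subsetP=> x /(subsetP (sub_cover F' F'c)) xc; rewrite inE; apply/eqP.
exact: rigid_motion_extend Fd (gh F Fd) aA mF (sub_cover F Fc) triv x xc.
Qed.

(** * From infinitesimal to generic rigidity *)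

Section GenericRigidity.
Variables (R : realType) (d : nat).

Lemma euclid_distE (x y : 'rV[R]_d) :
  euclid_dist x y = Num.sqrt (dot (x - y) (x - y)).
Proof. by congr Num.sqrt; apply: eq_bigr => i _; rewrite !mxE -expr2. Qed.

Lemma dot_ge0 (x : 'rV[R]_d) : 0 <= dot x x.
Proof. by apply: sumr_ge0 => i _; rewrite -expr2 sqr_ge0. Qed.

Lemma euclid_dist_eq (x y x' y' : 'rV[R]_d) :
  euclid_dist x y = euclid_dist x' y' <-> dot (x - y) (x - y) = dot (x' - y') (x' - y').
Proof.
rewrite !euclid_distE; split=> [/eqP|->//].
by rewrite eqr_sqrt ?dot_ge0 // => /eqP.
Qed.

Lemma coord_le_euclid_dist (x y : 'rV[R]_d) i : `|y 0 i - x 0 i| <= euclid_dist x y.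
Proof.
rewrite distrC -sqrtr_sqr ler_wsqrtr // (bigD1 i) //= lerDl.
by apply: sumr_ge0 => j _; rewrite sqr_ge0.
Qed.

(* |a|^2 - |b|^2 = <a - b, a + b>. *)
Lemma midpoint_dot (V : finType) (f g : V -> 'rV[R]_d) x y :
  dot (f x - g x - (f y - g y)) (line f g 2^-1 x - line f g 2^-1 y) = 0 <->
  dot (g x - g y) (g x - g y) = dot (f x - f y) (f x - f y).
Proof.
have -> : line f g 2^-1 x - line f g 2^-1 y = 2^-1 *: ((f x - f y) + (g x - g y)).
  by apply/rowP=> i; rewrite !mxE; field.
have -> : f x - g x - (f y - g y) = (f x - f y) - (g x - g y).
  by apply/rowP=> i; rewrite !mxE; ring.
move: (f x - f y) (g x - g y) => a b.
have -> : dot (a - b) (2^-1 *: (a + b)) = 2^-1 * (dot a a - dot b b).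
  by rewrite dotZr dotBl (dotC a (a + b)) (dotC b (a + b)) !dotDl (dotC b a); ring.
split=> [/eqP|->].
  by rewrite mulf_eq0 invr_eq0 pnatr_eq0 /= subr_eq0 => /eqP->.
by rewrite subrr mulr0.
Qed.

Lemma near_coordinates (T : finType) (f : {ptws T -> 'rV[R]_d}) (e : R) : 0 < e ->
  \forall g \near f, forall v i, `|(g : T -> 'rV[R]_d) v 0 i - f v 0 i| < e.
Proof.
move=> e0.
apply: (@filter_forall _ T (fun v (g : {ptws T -> 'rV[R]_d}) =>
  forall i, `|(g : T -> 'rV[R]_d) v 0 i - f v 0 i| < e) (nbhs f)) => v.
apply: (@filter_forall _ 'I_d (fun i (g : {ptws T -> 'rV[R]_d}) =>
  `|(g : T -> 'rV[R]_d) v 0 i - f v 0 i| < e) (nbhs f)) => i.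
have : ((fun g : {ptws T -> 'rV[R]_d} => g v 0 i) @ f --> f v 0 i)%classic.
  apply: (@continuous_comp {ptws T -> 'rV[R]_d} 'rV[R]_d R
    (fun g => g v) (fun x => x 0 i)).
    exact: proj_continuous.
  exact: coord_continuous.
by move=> /cvgrPdist_lt/(_ e e0); apply: filterS => g; rewrite distrC.
Qed.

Lemma line_cvg (T : finType) (f g : T -> 'rV[R]_d) :
  ({ptws, (fun t => line f g t) @ (0 : R) --> f})%classic.
Proof.
apply/cvg_sup => v A [B [[U openU <-] Uf UA]].
have lv : ((fun t : R => line f g t v) @ (0 : R) --> f v)%classic.
  rewrite /line -[X in (_ --> X)%classic]addr0 -(scale0r (g v - f v)).
  apply: cvgD; first exact: cvg_cst.
  by apply: cvgZr_tmp; exact: cvg_id.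
have lvU : \forall t \near (0 : R), U (line f g t v).
  by apply: lv; exact: open_nbhs_nbhs.
by near=> t; apply: UA; near: t.
Unshelve. all: by end_near.
Qed.

Variables (V : finType) (K : {set {set V}}).
Hypothesis cK : simplicial_complex K.

Lemma simplex_vertex S x : S \in K -> x \in S -> exists v : vertex K, val v = x.
Proof.
move=> SK xS; have xK : [set x] \in K by apply: (cK.2 _ _ SK); rewrite sub1set.
by exists (Sub x xK).
Qed.

(** Elements of V that are not vertices of K keep their place in [f0], so closeness to [f0] is a
    condition on the vertices only. *)
Definition extend (f0 : V -> 'rV[R]_d) (g : vertex K -> 'rV[R]_d) x :=
  if insub x is Some v then g v else f0 x.

Lemma extendE f0 g (v : vertex K) : extend f0 g (val v) = g v.
Proof. by rewrite /extend valK. Qed.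

Lemma near_extend (e : R) (f0 : V -> 'rV[R]_d) (g : vertex K -> 'rV[R]_d) : 0 < e ->
  (forall (v : vertex K) i, `|g v 0 i - f0 (val v) 0 i| < e) ->
  near_config e (extend f0 g) f0.
Proof.
move=> e0 gf x i; rewrite /extend; case: insubP => [v _ <-|_]; first exact: gf.
by rewrite subrr normr0.
Qed.

Theorem generically_rigid_skeleton1 : generic (@rigid_at R d V K) ->
  generically_rigid R d (skeleton1 K).
Proof.
move=> [B [[h0 Bh0] openB lineB] BK].
exists (fun f => exists2 f0, B f0 & forall v, f0 (val v) = f v); split.
- rewrite openE => f [f0 Bf0 f0E]; have [e e0 eB] := openB f0 Bf0.
  apply: (@filterS {ptws vertex K -> 'rV[R]_d} (nbhs f) (nbhs_filter f) _ _ _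
    (near_coordinates f e0)) => g gf.
  exists (extend f0 g) => [|v]; last exact: extendE.
  by apply/eB/near_extend => // v i; rewrite f0E.
(* Density: [f] is approached along its line to [h0]. The polynomial is attached to the end [h0],
   hence the flip to [1 - t]. *)
- move=> O [f Of] openO; have [P P0 PB] := lineB h0 Bh0 (extend h0 f).
  pose h1 (v : vertex K) := h0 (val v).
  have /nbhs_ballP[e /= e0 eO] := @line_cvg _ f h1 O (open_nbhs_nbhs (conj openO Of)).
  have [t [t0 te Pt]] := small_nonroot (flip_neq0 P0) e0.
  exists (line f h1 t); split.
    by apply: eO; rewrite /ball /= sub0r normrN gtr0_norm.
  exists (line h0 (extend h0 f) (1 - t)) => [|v].
    by apply: PB; move: Pt; rewrite horner_comp !hornerE.
  by rewrite lineC opprB addrC subrK /line extendE.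
(* The radius [e] of openness of [B] at [f0] serves as radius of rigidity: the midpoint is even
   closer to [f0] than [g], so it is still in [B]. *)
move=> f [f0 Bf0 f0E]; have [e e0 eB] := openB f0 Bf0; exists e => // g gf eqd u w.
pose h := line f0 (extend f0 g) 2^-1.
have /BK rh : B h.
  apply: eB => x i; rewrite !mxE.
  have : near_config e (extend f0 g) f0.
    apply: near_extend => // v j; rewrite f0E.
    exact: le_lt_trans (coord_le_euclid_dist _ _ _) (gf v).
  by move=> /(_ x i); rewrite !ltr_norml; lra.
pose m x := f0 x - extend f0 g x.
have fm : flex K h m.
  move=> S SK x y xS yS; have [->|xy] := eqVneq x y; first by rewrite subrr dot0l.
  have [u' xE] := simplex_vertex SK xS; have [w' yE] := simplex_vertex SK yS.
  apply/midpoint_dot; rewrite -xE -yE !extendE !f0E; apply/euclid_dist_eq/eqd.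
  rewrite /skeleton1 -val_eqE xE yE xy; apply: (cK.2 _ _ SK).
  by rewrite subUset !sub1set xS.
have cov (v : vertex K) : val v \in cover K.
  by apply/bigcupP; exists [set val v]; [exact: (svalP v)|exact: set11].
have := trivial_flex_dot (rh m fm) (cov u) (cov w).
by move/midpoint_dot; rewrite !extendE !f0E => /euclid_dist_eq.
Qed.

End GenericRigidity.

Theorem theorem1p3 (R : realType) (d : nat) (k : fieldType) (V : finType)
    (K : {set {set V}}) :
  (3 <= d)%N ->
  simplicial_complex K ->
  cplx_dim K = d%:Z - 1 ->
  two_CM k K ->
  generically_rigid R d (skeleton1 K).
Proof.
case: d => [|[|[|n]]] // _ cK dK cmK.
exact/generically_rigid_skeleton1/(generic_rigid_two_CM R cK dK cmK).
Qed.
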